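(* Let $d\ge 2$ and let $(\mathbf{X}_i)_{i\in\mathbb{Z}}$ be a strictly stationary sequence of $\mathbb{R}^d$-valued random vectors whose common distribution function $F$ has continuous marginal distribution functions $F_1,\dots,F_d$ and copula $C$. For each $n$ let $M_1,\dots,M_n$ (possibly depending on $n$) be non-negative real-valued random variables with $\sum_{i=1}^nM_i=n$. Suppose that: (1) $\alpha_n=\sqrt{n}(G_n-C)$ converges weakly in $\ell^\infty([0,1]^d)$ to a tight, centered Gaussian field $\mathbb{B}_C$ concentrated on $\mathbb{D}_0$; (2) $\alpha_{n,b}=\sqrt{n}(G_{n,b}-G_n)$ converges weakly in $\ell^\infty([0,1]^d)$ to $\mathbb{B}_C$ conditional on the data in probability; (3) for each $p=1,\dots,d$ the partial derivative $\partial_pC(\mathbf{u})$ exists and is continuous on $\{\mathbf{u}\in[0,1]^d: u_p\in(0,1)\}$. Then $\mathbb{C}_{n,b}=\sqrt{n}(C_{n,b}-C_n)$ converges weakly in $\ell^\infty([0,1]^d)$, conditional on the data in probability, to the Gaussian field $$\mathbb{G}_C(\mathbf{u})=\mathbb{B}_C(\mathbf{u})-\sum_{p=1}^d\partial_pC(\mathbf{u})\,\mathbb{B}_C(\mathbf{u}^{(p)}),\qquad\mathbf{u}\in[0,1]^d.$$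
   Context: Notation. $\ell^\infty([0,1]^d)$ is the space of bounded real functions on $[0,1]^d$ with the supremum norm; (unconditional) weak convergence is in the Hoffmann-J\o rgensen sense. $C([0,1]^d)$ denotes the continuous real functions on $[0,1]^d$. Inequalities between vectors are componentwise and $\mathbb{I}$ denotes an indicator. Copula. $C$ is the unique distribution function on $[0,1]^d$ with standard uniform univariate marginals such that $F(\mathbf{x})=C(F_1(x_1),\dots,F_d(x_d))$ for all $\mathbf{x}\in\mathbb{R}^d$. Write $\mathbf{X}_i=(X_{i1},\dots,X_{id})$, $U_{ip}=F_p(X_{ip})$, $\mathbf{U}_i=(U_{i1},\dots,U_{id})$, and $$F_n(\mathbf{x})=\frac1n\sum_{i=1}^n\mathbb{I}\{\mathbf{X}_i\le\mathbf{x}\},\quad G_n(\mathbf{u})=\frac1n\sum_{i=1}^n\mathbb{I}\{\mathbf{U}_i\le\mathbf{u}\},$$ $$F_{n,b}(\mathbf{x})=\frac1n\sum_{i=1}^nM_i\,\mathbb{I}\{\mathbf{X}_i\le\mathbf{x}\},\quad G_{n,b}(\mathbf{u})=\frac1n\sum_{i=1}^nM_i\,\mathbb{I}\{\mathbf{U}_i\le\mathbf{u}\}.$$ For a distribution function $H$ on $\mathbb{R}$, its generalized inverse is $H^-(q)=\inf\{x\in\mathbb{R}: H(x)\ge q\}$ for $0<q\le1$ and $H^-(0)=\sup\{x\in\mathbb{R}: H(x)=0\}$. For a $d$-variate distribution function $H$ with marginals $H_1,\dots,H_d$ write $H^-(\mathbf{u})=(H_1^-(u_1),\dots,H_d^-(u_d))$.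 The empirical copula is $C_n(\mathbf{u})=F_n(F_n^-(\mathbf{u}))$, and the bootstrap empirical copula is $C_{n,b}(\mathbf{u})=F_{n,b}(F_{n,b}^-(\mathbf{u}))=G_{n,b}(G_{n,b}^-(\mathbf{u}))$. $\mathbb{D}_0=\{\alpha\in C([0,1]^d): \alpha(1,\dots,1)=0$ and $\alpha(\mathbf{x})=0$ if some of the components of $\mathbf{x}$ are equal to $0\}$. Conditional weak convergence. A sequence $Y_n$ of $\ell^\infty([0,1]^d)$-valued maps of $(\mathbf{X}_1,\dots,\mathbf{X}_n,M_1,\dots,M_n)$ converges weakly to $Y$ conditional on the data in probability if (i) $\sup_{f\in\mathrm{BL}_1}|\mathbb{E}_Mf(Y_n)-\mathbb{E}f(Y)|\to0$ in outer probability, and (ii) $\mathbb{E}_Mf(Y_n)^*-\mathbb{E}_Mf(Y_n)_*\to0$ in probability for all $f\in\mathrm{BL}_1$. Here $\mathrm{BL}_1$ is the set of all functions $f:\ell^\infty([0,1]^d)\to\mathbb{R}$ that are bounded by $1$ and Lipschitz with constant at most $1$; $\mathbb{E}_M$ denotes expectation over the weights $M_1,\dots,M_n$ conditional on the data $\mathbf{X}_1,\dots,\mathbf{X}_n$; and ${}^*$, ${}_*$ denote measurable majorants and minorants with respect to the joint data $(\mathbf{X}_1,\dots,\mathbf{X}_n,M_1,\dots,M_n)$. The function $\partial_pC$ is defined as $0$ on $\{\mathbf{u}\in[0,1]^d: u_p\in\{0,1\}\}$. The vector $\mathbf{u}^{(p)}=(1,\dots,1,u_p,1,\dots,1)$ is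 obtained from $\mathbf{u}$ by replacing all entries except the $p$-th by $1$. *)

(* Defs.v *)
From HB Require Import structures.
From mathcomp Require Import all_boot all_order all_algebra.
From mathcomp Require Import all_classical all_reals all_analysis.
From mathcomp Require Import measurable_realfun.

Set Implicit Arguments.
Unset Strict Implicit.
Unset Printing Implicit Defensive.

Import Order.TTheory GRing.Theory Num.Theory.
Import numFieldNormedType.Exports.

Local Open Scope classical_set_scope.
Local Open Scope ring_scope.

(** * The space of bounded functions with the supremum norm *)

Section linfty_def.
Context {R : realType} {T : Type}.

Definition bddfun : {pred T -> R} := mem [set h : T -> R | bounded_fun h].
Definition bddfun_key : pred_key bddfun. Proof. exact. Qed.
Canonical bddfun_keyed := KeyedPred bddfun_key.

Lemma bddfunP (h : T -> R) :
  reflect (exists c, forall u, `|h u| <= c) (h \in bddfun).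
Proof.
apply: (iffP idP).
  rewrite inE => -[c [_ hc]]; exists (c + 1) => u.
  by apply: (hc (c + 1)) => //; rewrite ltrDl.
move=> [c hc]; rewrite inE; exists c; split; first exact: num_real.
by move=> x cx u _; exact: le_trans (hc u) (ltW cx).
Qed.

Lemma bddfun_submod_closed : submod_closed bddfun.
Proof.
split; first by apply/bddfunP; exists 0 => u; rewrite normr0.
move=> a f g /bddfunP[b hb] /bddfunP[c hc]; apply/bddfunP.
exists (`|a| * b + c) => u; apply: le_trans (ler_normD _ _) _.
by apply: lerD => //; rewrite normrM ler_wpM2l.
Qed.

HB.instance Definition _ :=
  GRing.isSubmodClosed.Build R (T -> R) bddfun bddfun_submod_closed.

End linfty_def.

Record linfty (R : realType) (T : Type) := Linfty {
  linfty_fun :> T -> R ;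
  linfty_bdd : linfty_fun \in bddfun }.

Section linfty_normed.
Context (R : realType) (T : Type).

HB.instance Definition _ := [isSub for @linfty_fun R T].
HB.instance Definition _ := [Choice of linfty R T by <:].
HB.instance Definition _ := [SubChoice_isSubLmodule of linfty R T by <:].

Implicit Types f g : linfty R T.

Definition linfty_norm f : R := sup (range (fun u => `|f u|)).

Lemma linfty_has_ubound f : has_ubound (range (fun u => `|f u|)).
Proof.
by have /bddfunP[c hc] := linfty_bdd f; exists c => _ [u _ <-].
Qed.

Lemma linfty_norm_ge f u : `|f u| <= linfty_norm f.
Proof. by apply: ub_le_sup; [exact: linfty_has_ubound | exists u]. Qed.

Lemma linfty_norm_le f c : 0 <= c -> (forall u, `|f u| <= c) ->
  linfty_norm f <= c.
Proof.
move=> c0 hc; rewrite /linfty_norm.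
have [->|/set0P ne] := eqVneq (range (fun u => `|f u|)) set0.
  by rewrite sup0.
by apply: ge_sup => // _ [u _ <-].
Qed.

Lemma linfty_norm_ge0 f : 0 <= linfty_norm f.
Proof.
have [e|/set0P[_ [u _ _]]] := eqVneq (range (fun u => `|f u|)) set0.
  by rewrite /linfty_norm e sup0.
exact: le_trans (linfty_norm_ge f u).
Qed.

Lemma linfty_normD f g :
  linfty_norm (f + g) <= linfty_norm f + linfty_norm g.
Proof.
apply: linfty_norm_le => [|u]; first by rewrite addr_ge0 ?linfty_norm_ge0.
by apply: le_trans (ler_normD _ _) _; rewrite lerD// linfty_norm_ge.
Qed.

Lemma linfty_normZ_le (l : R) f :
  linfty_norm (l *: f) <= `|l| * linfty_norm f.
Proof.
apply: linfty_norm_le => [|u]; first by rewrite mulr_ge0 ?linfty_norm_ge0.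
by apply: le_trans (_ : `|l| * `|f u| <= _);
  [rewrite -normrM | rewrite ler_wpM2l// linfty_norm_ge].
Qed.

Lemma linfty_normZ (l : R) f : linfty_norm (l *: f) = `|l| * linfty_norm f.
Proof.
apply/eqP; rewrite eq_le linfty_normZ_le /=.
have [->|l0] := eqVneq l 0; first by rewrite normr0 mul0r linfty_norm_ge0.
rewrite -ler_pdivlMl ?normr_gt0// -normfV.
by rewrite -[X in linfty_norm X <= _](scalerK l0) linfty_normZ_le.
Qed.

Lemma linfty_norm0_eq0 f : linfty_norm f = 0 -> f = 0.
Proof.
move=> f0; apply/val_inj/funext => u /=; apply/eqP.
by rewrite -normr_le0 -f0 linfty_norm_ge.
Qed.

HB.instance Definition _ := Lmodule_isNormed.Build R (linfty R T)
  linfty_normD linfty_normZ linfty_norm0_eq0.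

End linfty_normed.

(* [h] as an element of l^infty; the junk value 0 is only returned when [h] is
   unbounded. *)
Definition linfty_of (R : realType) (T : Type) (h : T -> R) : linfty R T :=
  insubd (0 : linfty R T) h.

(** * Outer integrals, measurable majorants, weak convergence *)

Section weak_convergence.
Context {R : realType}.
Local Open Scope ereal_scope.

Definition outer_integral d (T : measurableType d)
    (mu : {measure set T -> \bar R}) (h : T -> R) : \bar R :=
  ereal_inf [set \int[mu]_w U w | U in [set U : T -> \bar R |
    mu.-integrable setT U /\ forall w, (h w)%:E <= U w]].

(* [U] is a version of h^* on the space [S], with respect to the law of
   [J : T -> S] under [P]. *)
Definition measurable_majorant d dS (T : measurableType d)
    (S : measurableType dS) (P : probability T R) (J : T -> S)
    (h : S -> R) (U : S -> \bar R) :=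
  [/\ measurable_fun setT U, forall z, (h z)%:E <= U z &
      forall V : S -> \bar R, measurable_fun setT V ->
        (forall z, (h z)%:E <= V z) -> {ae P, forall w, U (J w) <= V (J w)}].

Definition measurable_minorant d dS (T : measurableType d)
    (S : measurableType dS) (P : probability T R) (J : T -> S)
    (h : S -> R) (L : S -> \bar R) :=
  measurable_majorant P J (fun z => (- h z)%R) (fun z => - L z).

Context {V : normedModType R}.

Definition borel_map d (T : measurableType d) (Y : T -> V) :=
  forall O : set V, open O -> measurable (Y @^-1` O).

Definition tight d (T : measurableType d) (P : probability T R) (Y : T -> V) :=
  forall e : R, (0 < e)%R ->
    exists2 K : set V, compact K & (1 - e)%:E <= P (Y @^-1` K).

Definition BL1 : set (V -> R) :=
  [set f | (forall z, `|f z| <= 1)%R /\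
           (forall z z', `|f z - f z'| <= `|z - z'|)%R].

Definition weak_cvg d d' (T : measurableType d) (P : probability T R)
    (Z : nat -> T -> V) (T' : measurableType d') (P' : probability T' R)
    (Y : T' -> V) :=
  borel_map Y /\
  forall f : V -> R, continuous f -> (exists c, forall z, `|f z| <= c)%R ->
    outer_integral P (fun w => f (Z n w)) @[n --> \oo] -->
      'E_P'[fun w => f (Y w)].

(* [D n] and [W n] are the data and the weights of the [n]-th experiment, [K n]
   a regular conditional law of [W n] given [D n], and [Z n] is a map of both.
   The conditional expectation E_M of a map [h] of data and weights is the
   (outer) integral of [h] over the weights with respect to [K n (D n w)]; the
   outer integral is needed as [Z n] need not be measurable. Versions of the
   majorant and the minorant always exist here since [f] is bounded, they are
   unique up to almost sure equality and (ii) does not depend on their choice. *)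
Definition cond_weak_cvg d dD dW (T : measurableType d) (P : probability T R)
    (TD : nat -> measurableType dD) (TW : nat -> measurableType dW)
    (D : forall n, T -> TD n) (W : forall n, T -> TW n)
    (K : forall n, R.-pker (TD n) ~> (TW n)) (Z : forall n, TD n -> TW n -> V)
    d' (T' : measurableType d') (P' : probability T' R) (Y : T' -> V) :=
  [/\ borel_map Y,
      (* (i) *)
      forall e : R, (0 < e)%R ->
        (P^*)%mu [set w | e%:E < ereal_sup
          [set `| outer_integral (K n (D n w)) (fun m => f (Z n (D n w) m))
                  - 'E_P'[fun w' => f (Y w')] | | f in BL1] ]
          @[n --> \oo] --> 0 &
      (* (ii) *)
      forall f, BL1 f ->
        exists U L : forall n, TD n * TW n -> \bar R,
        [/\ forall n, measurable_majorant P (fun w => (D n w, W n w))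
              (fun z => f (Z n z.1 z.2)) (U n),
            forall n, measurable_minorant P (fun w => (D n w, W n w))
              (fun z => f (Z n z.1 z.2)) (L n) &
            forall e : R, (0 < e)%R ->
              P [set w | e%:E < `| \int[K n (D n w)]_m U n (D n w, m)
                                   - \int[K n (D n w)]_m L n (D n w, m) | ]
                @[n --> \oo] --> 0] ].

Definition is_cond_law d dD dW (T : measurableType d) (P : probability T R)
    (TD : measurableType dD) (TW : measurableType dW)
    (D : T -> TD) (W : T -> TW) (K : R.-pker TD ~> TW) :=
  forall A B, measurable A -> measurable B ->
    P (D @^-1` A `&` W @^-1` B) = \int[P]_(w in D @^-1` A) K (D w) B.

End weak_convergence.

(** * Gaussian fields, stationarity *)

Section processes.
Context {R : realType} d (T : measurableType d) (P : probability T R).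

(* [normal_prob m 0] is not the degenerate normal law. *)
Definition gaussian_rv (Z : T -> R) :=
  exists m s : R, 0 <= s /\ forall A : set R, measurable A ->
    P (Z @^-1` A) = (if s == 0 then \d_m A else normal_prob m s A).

Definition gaussian_field (I : Type) (Y : T -> I -> R) :=
  forall k (a : 'I_k -> R) (u : 'I_k -> I),
    gaussian_rv (fun w => \sum_(j < k) a j * Y w (u j)).

Definition centered_field (I : Type) (Y : T -> I -> R) :=
  forall u, ('E_P[fun w => Y w u] = 0)%E.

Definition strictly_stationary d' (S : measurableType d') (X : int -> T -> S) :=
  forall k (t : 'I_k -> int) (h : int) (A : set (k.-tuple S)), measurable A ->
    P [set w | A [tuple X (t j + h) w | j < k]] =
    P [set w | A [tuple X (t j) w | j < k]].

End processes.

(** * Distribution functions and copulas *)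

Section copulas.
Context {R : realType} {d : nat}.

Definition cube : set 'rV[R]_d := [set u | forall p, 0 <= u ord0 p <= 1].

Definition margin_vec (u : 'rV[R]_d) (p : 'I_d) : 'rV[R]_d :=
  \row_q (if q == p then u ord0 p else 1).

Lemma cube_margin_vec u p : cube u -> cube (margin_vec u p).
Proof. by move=> hu q; rewrite mxE; case: eqP => _ //; rewrite ler01 lexx. Qed.

Definition cube_margin (u : cube) (p : 'I_d) : cube :=
  SigSub (mem_set (cube_margin_vec p (set_mem (svalP u)))).

Definition le_vec (y : d.-tuple R) (x : 'rV[R]_d) : bool :=
  [forall p, tnth y p <= x ord0 p].

Definition is_copula (C : 'rV[R]_d -> R) :=
  (exists nu : probability (d.-tuple R) R,
     forall u, cube u -> (C u)%:E = nu [set y | le_vec y u]) /\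
  (forall u p, cube u -> C (margin_vec u p) = u ord0 p).

Definition joint_df d0 (T : measurableType d0) (P : probability T R)
    (Z : T -> d.-tuple R) (x : 'rV[R]_d) : R :=
  fine (P [set w | le_vec (Z w) x]).

Definition marginal_df d0 (T : measurableType d0) (P : probability T R)
    (Z : T -> d.-tuple R) (p : 'I_d) (t : R) : R :=
  fine (P [set w | tnth (Z w) p <= t]).

Definition copula_of d0 (T : measurableType d0) (P : probability T R)
    (Z : T -> d.-tuple R) (C : 'rV[R]_d -> R) :=
  is_copula C /\
  forall x, joint_df P Z x = C (\row_p marginal_df P Z p (x ord0 p)).

Definition has_pderive (C : 'rV[R]_d -> R) (p : 'I_d) (u : 'rV[R]_d) :=
  derivable C u (delta_mx ord0 p).

Definition pderive (C : 'rV[R]_d -> R) (p : 'I_d) (u : 'rV[R]_d) : R :=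
  if 0 < u ord0 p < 1 then 'D_(delta_mx ord0 p) C u else 0.

Definition D0 : set (linfty R cube) :=
  [set a : linfty R cube | [/\ continuous (a : cube -> R),
    forall u : cube, (forall p, val u ord0 p = 1) -> a u = 0 &
    forall u : cube, (exists p, val u ord0 p = 0) -> a u = 0]].

(* Phi'(a)(u) = a(u) - sum_p d_p C(u) a(u^(p)); this is a bounded function since
   the partial derivatives of a copula take values in [0, 1]. *)
Definition copula_derivative (C : 'rV[R]_d -> R) (a : linfty R cube) :
    linfty R cube :=
  linfty_of (fun u : cube =>
    a u - \sum_(p < d) pderive C p (val u) * a (cube_margin u p)).

End copulas.

Arguments cube : clear implicits.

(** * Empirical processes *)

Section empirical.
Context {R : realType} {d : nat}.

(* Used for distribution functions [H] on the line and [q] in [0, 1]. *)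
Definition ginv (H : R -> R) (q : R) : R :=
  if 0 < q then inf [set t | q <= H t] else sup [set t | H t = 0].

Section sample.
Context {n : nat}.
Implicit Types (x : n.-tuple (d.-tuple R)) (m : n.-tuple R).

Definition edf x (v : 'rV[R]_d) : R :=
  n%:R^-1 * \sum_(i < n) (le_vec (tnth x i) v)%:R.

Definition edf_marg x (p : 'I_d) (t : R) : R :=
  n%:R^-1 * \sum_(i < n) (tnth (tnth x i) p <= t)%R%:R.

Definition bedf x m (v : 'rV[R]_d) : R :=
  n%:R^-1 * \sum_(i < n) tnth m i * (le_vec (tnth x i) v)%:R.

Definition bedf_marg x m (p : 'I_d) (t : R) : R :=
  n%:R^-1 * \sum_(i < n) tnth m i * (tnth (tnth x i) p <= t)%R%:R.

Definition emp_copula x (u : 'rV[R]_d) : R :=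
  edf x (\row_p ginv (edf_marg x p) (u ord0 p)).

Definition boot_copula x m (u : 'rV[R]_d) : R :=
  bedf x m (\row_p ginv (bedf_marg x m p) (u ord0 p)).

(* The sample U_i = (F_1(X_i1), ..., F_d(X_id)); G_n and G_{n,b} are its [edf]
   and [bedf]. *)
Definition unif_sample (F : 'I_d -> R -> R) x : n.-tuple (d.-tuple R) :=
  [tuple [tuple F p (tnth (tnth x i) p) | p < d] | i < n].

Definition alpha (F : 'I_d -> R -> R) (C : 'rV[R]_d -> R) x :
    linfty R (cube R d) :=
  linfty_of (fun u : cube R d =>
    Num.sqrt n%:R * (edf (unif_sample F x) (val u) - C (val u))).

Definition alpha_boot (F : 'I_d -> R -> R) x m : linfty R (cube R d) :=
  linfty_of (fun u : cube R d =>
    Num.sqrt n%:R * (bedf (unif_sample F x) m (val u)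
                     - edf (unif_sample F x) (val u))).

Definition copula_boot x m : linfty R (cube R d) :=
  linfty_of (fun u : cube R d =>
    Num.sqrt n%:R * (boot_copula x m (val u) - emp_copula x (val u))).

End sample.

Definition sample d0 (T : measurableType d0) (X : int -> T -> d.-tuple R)
    (n : nat) (w : T) : n.-tuple (d.-tuple R) :=
  [tuple X (i.+1)%:Z w | i < n].

End empirical.

(* Main.v *)
Require Import Defs.
From HB Require Import structures.
From mathcomp Require Import all_boot all_order all_algebra.
From mathcomp Require Import all_classical all_reals all_analysis.
From mathcomp Require Import measurable_realfun.
From mathcomp Require Import ring lra.

Set Implicit Arguments.
Unset Strict Implicit.
Unset Printing Implicit Defensive.

Import Order.TTheory GRing.Theory Num.Theory.
Import numFieldNormedType.Exports.

Local Open Scope classical_set_scope.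
Local Open Scope ring_scope.

(** The bootstrap copula is a functional of the weighted empirical distribution
    function of the sample U_i = F(X_i), and the theorem is the delta method for
    that functional. Write a_n and b_n for [alpha] and [alpha_boot], so that
    sqrt n (G_{n,b} - C) = a_n + b_n, and let Phi' be the continuous linear map
    [copula_derivative]. The heart of the matter is that the remainder

      R_n = [copula_boot] - Phi'(b_n)

    is negligible in outer probability, jointly in the data and the weights.
    Since Phi' is Lipschitz and linear, conditional weak convergence of b_n to B
    then passes to [copula_boot] and Phi'(B) ([cond_weak_cvg_perturb]).

    Smallness of R_n is a deterministic fact about weighted samples. The limit
    lives on continuous functions on a compact cube that vanish on the lower
    faces and at the upper corner. All that is used of this is recorded by one
    seminorm, [gauge k]: the oscillation at scale 1/(k+1), the values on those
    faces and corner, and 1/(k+1) times the sup norm. It tends to 0 on the space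
    [D0], and it is Lipschitz, so that min(1, gauge / 2) is a test function for
    weak convergence ([gauge_test]); hence a_n and b_n have a small gauge
    with large probability, for a suitable k and large n. On that event one
    computes as in the smooth case ([boot_copula_expansion]). The atoms of the
    weighted sample have mass o(1/sqrt n), for an atom is a jump of
    C + b/sqrt n with C Lipschitz and b almost continuous. So ties, the lack of
    strict monotonicity of the F_p and the convention for the quantile at 0 cost
    only o(1/sqrt n): the quantile at u_p moves to some s_p with
    s_p = u_p - b(u^(p))/sqrt n + o(1/sqrt n). Then C(s) - C(u) is expanded one
    coordinate at a time. If u_p is bounded away from 0 and 1, the mean value
    theorem and the uniform continuity of the partial derivative apply; if not,
    b(u^(p)) is itself small and the Lipschitz bound suffices. Applying the
    expansion to the bootstrap weights and to unit weights and subtracting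
    bounds R_n ([remainder_eventually_small]).

    The rest is measure theory for maps that need not be measurable. For
    functions bounded by 1, part (ii) of conditional convergence is equivalent
    to the convergence to 0 of the unconditional mean of the difference of
    majorant and minorant ([majorant_gap], [optimal_gap]); this rests on the
    disintegration of the joint law of data and weights along the kernel. The
    exceptional event must be a measurable set of pairs of data and weights. For
    b_n it is a level set of a measurable majorant of the gauge, whose mean is
    controlled by the two parts of the hypothesis ([asymptotic_upper]). For
    a_n only an outer integral on the sample space is controlled, so the event is
    described by countably many evaluations, using that a_n is right continuous
    ([rough_set]). *)

(** * Copulas: increments and partial derivatives *)

Section copula_facts.
Context {R : realType} {d : nat}.
Implicit Types (u v : 'rV[R]_d) (p : 'I_d).

Definition set_coord u p (t : R) : 'rV[R]_d :=
  \row_q (if q == p then t else u ord0 q).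

Lemma set_coordE u p t : set_coord u p t ord0 p = t.
Proof. by rewrite mxE eqxx. Qed.

Lemma set_coord_id u p : set_coord u p (u ord0 p) = u.
Proof. by apply/rowP => q; rewrite mxE; case: eqP => [->|]. Qed.

Lemma set_coordK2 u p s t : set_coord (set_coord u p s) p t = set_coord u p t.
Proof. by apply/rowP => q; rewrite !mxE; case: eqP. Qed.

Lemma cube_set_coord u p t : cube R d u -> 0 <= t <= 1 -> cube R d (set_coord u p t).
Proof. by move=> hu ht q; rewrite mxE; case: ifP. Qed.

Lemma set_coord_delta u p h : set_coord u p (h + u ord0 p) = h *: delta_mx ord0 p + u.
Proof.
apply/rowP => q; rewrite !mxE /= .
by case: eqP => [->|]; rewrite ?mulr1 ?mulr0 ?add0r.
Qed.

Lemma measurable_le_vec u : measurable [set y : d.-tuple R | le_vec y u].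
Proof.
rewrite (_ : [set _ | _] =
    \bigcap_(p in [set: 'I_d]) ((fun y => @tnth d R y p) @^-1` `]-oo, u ord0 p])).
  apply: fin_bigcap_measurable => [|p _]; first exact: finite_finset.
  rewrite -[X in measurable X]setTI.
  exact: measurable_tnth.
apply/seteqP; split => [y /= /forallP h p _ | y /= h].
  by rewrite /= in_itv/=.
by apply/forallP => p; have := h p I; rewrite /= in_itv/=.
Qed.

Variable C : 'rV[R]_d -> R.
Hypothesis copC : is_copula C.

Lemma copula_mono u v : cube R d u -> cube R d v ->
  (forall p, u ord0 p <= v ord0 p) -> C u <= C v.
Proof.
case: copC => -[nu hnu] _ hu hv uv.
rewrite -lee_fin !hnu//; apply: le_measure; rewrite ?inE; try exact: measurable_le_vec.
move=> y /= /forallP h; apply/forallP => p; exact: le_trans (h p) (uv p).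
Qed.

Lemma copula_ge0 u : cube R d u -> 0 <= C u.
Proof. by case: copC => -[nu hnu] _ hu; rewrite -lee_fin hnu. Qed.

Lemma copula_le1 u : cube R d u -> C u <= 1.
Proof.
case: copC => -[nu hnu] _ hu; rewrite -lee_fin hnu//.
exact: probability_le1 (measurable_le_vec u).
Qed.

(** Enlarging one coordinate adds to the lower orthant a part of a slab; the
    whole slab is added to the marginal orthant, whose mass is known. *)
Lemma copula_incr u p t : cube R d u -> u ord0 p <= t <= 1 ->
  0 <= C (set_coord u p t) - C u <= t - u ord0 p.
Proof.
move=> hu /andP[ut t1].
have hw : cube R d (set_coord u p t).
  apply: cube_set_coord => //; rewrite t1 andbT; apply: le_trans ut.
  by case/andP: (hu p).
have uw q : u ord0 q <= set_coord u p t ord0 q.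
  by rewrite mxE; case: eqP => [->|].
rewrite subr_ge0 copula_mono//=.
case: copC => -[nu hnu] hm.
have mw : C (margin_vec (set_coord u p t) p) = t by rewrite hm// set_coordE.
rewrite -{2}mw -(hm u p)// lerBlDr addrAC -lerBlDr.
have h1 := cube_margin_vec p hu; have h2 := cube_margin_vec p hw.
have nuD x y : cube R d x -> cube R d y -> (forall q, x ord0 q <= y ord0 q) ->
    (C y - C x)%:E = nu ([set z | le_vec z y] `\` [set z | le_vec z x]).
  move=> cx cy xy; rewrite measureD; last 3 first.
  - exact: measurable_le_vec.
  - exact: measurable_le_vec.
  - exact: le_lt_trans (probability_le1 nu (measurable_le_vec y)) (ltry _).
  rewrite (_ : _ `&` _ = [set z | le_vec z x]); first by rewrite EFinB !hnu.
  rewrite setIidr// => z /= /forallP h; apply/forallP => q.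
  exact: le_trans (h q) (xy q).
rewrite lerBlDr addrAC -lerBlDr -lee_fin !nuD//; last first.
  by move=> q; rewrite !mxE eqxx; case: eqP.
apply: le_measure; rewrite ?inE; try by
  apply: measurableD; exact: measurable_le_vec.
move=> z /= [/forallP hz nz]; split.
  apply/forallP => q; rewrite mxE; case: eqP => [->|/eqP qp]; first exact: hz.
  by apply: le_trans (hz q) _; case/andP: (hw q).
move=> /forallP h; apply: nz; apply/forallP => q.
have [->|/eqP qp] := eqVneq q p; first by have := h p; rewrite mxE eqxx.
by have := hz q; rewrite mxE; case: eqP.
Qed.

Lemma copula_lip1 u p t : cube R d u -> 0 <= t <= 1 ->
  `|C (set_coord u p t) - C u| <= `|t - u ord0 p|.
Proof.
move=> hu ht; have /andP[t0 t1] := ht; have [ut|tu] := leP (u ord0 p) t.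
  have /andP[h1 h2] : 0 <= C (set_coord u p t) - C u <= t - u ord0 p.
    by apply: copula_incr => //; rewrite ut t1.
  by rewrite ger0_norm// ger0_norm// subr_ge0.
have /andP[h1 h2] := @copula_incr (set_coord u p t) p (u ord0 p) (cube_set_coord p hu ht)
  ltac:(by rewrite set_coordE (ltW tu); case/andP: (hu p)).
rewrite set_coordK2 set_coord_id set_coordE in h1 h2.
by rewrite distrC [leRHS]distrC !ger0_norm// subr_ge0 ltW.
Qed.

(** The corners of the staircase joining [u] to [v] by changing one coordinate
    at a time. *)
Definition corner u v (k : nat) : 'rV[R]_d :=
  \row_q (if (q < k)%N then v ord0 q else u ord0 q).

Lemma corner_succ u v p : corner u v p.+1 = set_coord (corner u v p) p (v ord0 p).
Proof.
apply/rowP => q; rewrite !mxE ltnS leq_eqVlt.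
have [->|qp] := eqVneq q p; first by rewrite eqxx.
by rewrite (negbTE (_ : (q != p :> nat))).
Qed.

Lemma cube_corner u v k : cube R d u -> cube R d v -> cube R d (corner u v k).
Proof. by move=> hu hv q; rewrite mxE; case: ifP. Qed.

Lemma corner_diag u v p : corner u v p ord0 p = u ord0 p.
Proof. by rewrite mxE ltnn. Qed.

(** The p-th step of the staircase starts at a point whose p-th coordinate is still
    that of [u] ([corner_diag]), so that the increments are those of [u] and [v]. *)
Lemma corner_telescope u v (f : 'rV[R]_d -> R) : f v - f u =
  \sum_(p < d) (f (set_coord (corner u v p) p (v ord0 p)) - f (corner u v p)).
Proof.
under eq_bigr do rewrite -corner_succ.
rewrite -(big_mkord xpredT (fun k => f (corner u v k.+1) - f (corner u v k))).
rewrite telescope_sumr//; congr (f _ - f _).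
  by apply/rowP => q; rewrite mxE ltn_ord.
by apply/rowP => q; rewrite mxE.
Qed.

Lemma copula_lip u v : cube R d u -> cube R d v ->
  `|C v - C u| <= \sum_(p < d) `|v ord0 p - u ord0 p|.
Proof.
move=> hu hv; rewrite (corner_telescope u v C).
apply: le_trans (ler_norm_sum _ _ _) _; apply: ler_sum => p _.
by have := copula_lip1 p (cube_corner p hu hv) (hv p); rewrite corner_diag.
Qed.

Hypothesis C_derivable : forall p u, cube R d u -> 0 < u ord0 p < 1 ->
  has_pderive C p u.

(** The difference quotients of [C] at points of the cube lie in [0, 1], as [C] is
    nondecreasing and 1-Lipschitz in each coordinate. *)
Lemma pderive_range p u : cube R d u -> 0 <= pderive C p u <= 1.
Proof.
move=> hu; rewrite /pderive; case: ifPn => [u01|_]; last by rewrite lexx ler01.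
have dC := C_derivable hu u01.
have nearR : \forall h \near 0^',
    0 <= h^-1 *: ((C \o shift u) (h *: delta_mx ord0 p) - C u) <= 1.
  have /andP[u0 u1] := u01.
  near=> h; rewrite /= -set_coord_delta.
  have h0 : h != 0 by near: h; exact: nbhs_dnbhs_neq.
  have hm : `|h| < Num.min (u ord0 p) (1 - u ord0 p).
    near: h; apply: dnbhs0_lt; rewrite lt_min u0 subr_gt0 u1//.
  have [h1 h2] : - h <= u ord0 p /\ h <= 1 - u ord0 p.
    move: hm; rewrite lt_min => /andP[/ltW + /ltW]; rewrite !ler_norml.
    by move=> /andP[? ?] /andP[_ ?]; split; lra.
  have ht : 0 <= h + u ord0 p <= 1 by lra.
  have [hpos|hneg|/eqP] := ltgtP 0 h; last by rewrite eq_sym (negbTE h0).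
  - have /andP[i1 i2] := @copula_incr u p (h + u ord0 p) hu ltac:(by lra).
    rewrite addrK in i2; rewrite -[_ *: _]/(_ * _) mulr_ge0 ?invr_ge0 ?(ltW hpos)//=.
    by rewrite [leLHS]mulrC ler_pdivrMr// mul1r.
  - have := @copula_incr (set_coord u p (h + u ord0 p)) p (u ord0 p) (cube_set_coord p hu ht).
    rewrite set_coordK2 set_coord_id set_coordE => /(_ ltac:(by lra)) /andP[i1 i2].
    rewrite -[_ *: _]/(_ * _) -mulrNN -invrN opprB mulr_ge0//=; last first.
      by rewrite invr_ge0 oppr_ge0 ltW.
    by rewrite [leLHS]mulrC ler_pdivrMr ?oppr_gt0// mul1r; lra.
rewrite /derive; apply/andP; split.
  by apply: limr_ge; [exact: dC | by apply: filterS nearR => h /andP[]].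
by apply: limr_le; [exact: dC | by apply: filterS nearR => h /andP[]].
Unshelve. all: by end_near. Qed.

Lemma copula_slice_is_derive u p (t : R) : cube R d u -> 0 < t < 1 ->
  is_derive t 1 (fun s : R => C (set_coord u p s)) (pderive C p (set_coord u p t)).
Proof.
move=> hu t01; have t01' : 0 <= t <= 1 by lra.
have hw := cube_set_coord p hu t01'.
have ht : 0 < set_coord u p t ord0 p < 1 by rewrite set_coordE.
have := C_derivable hw ht; rewrite /has_pderive /pderive ht => dC.
have E : (fun h => h^-1 *: ((C \o shift (set_coord u p t)) (h *: delta_mx ord0 p)
                            - C (set_coord u p t))) =
  (fun h : R => h^-1 *: (((fun s => C (set_coord u p s)) \o shift t) (h *: 1)
                            - C (set_coord u p t))).
  apply/funext => h /=; rewrite -set_coord_delta set_coordK2 set_coordE.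
  by rewrite -[h *: 1]/(h * 1) mulr1.
split; first by rewrite /derivable -E.
by rewrite /derive -E.
Qed.

(** Both endpoints must be interior: at [t = 0] and [t = 1] the slice leaves the
    cube, outside of which [C] is arbitrary. *)
Lemma copula_MVT u p (t : R) : cube R d u -> 0 < u ord0 p < 1 -> 0 < t < 1 ->
  exists c, `|c - u ord0 p| <= `|t - u ord0 p| /\ 0 < c < 1 /\
    C (set_coord u p t) - C u = pderive C p (set_coord u p c) * (t - u ord0 p).
Proof.
move=> hu u01 t01.
have main (a b : R) : 0 < a -> b < 1 -> a <= b -> exists2 c, a <= c <= b &
    C (set_coord u p b) - C (set_coord u p a) = pderive C p (set_coord u p c) * (b - a).
  move=> a0 b1 ab.
  have der x : x \in `[a, b] ->
      is_derive x 1 (fun s : R => C (set_coord u p s)) (pderive C p (set_coord u p x)).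
    by rewrite in_itv/= => /andP[? ?]; apply: copula_slice_is_derive => //; lra.
  have cont : {within `[a, b], continuous (fun s : R => C (set_coord u p s))}.
    apply: derivable_within_continuous => x xab.
    exact: (@ex_derive _ _ _ _ _ _ _ (der x xab)).
  have der' x : x \in `]a, b[ ->
      is_derive x 1 (fun s : R => C (set_coord u p s)) (pderive C p (set_coord u p x)).
    by move=> xab; apply: der; exact: subset_itv_oo_cc.
  have [c cab e] := MVT_segment ab der' cont.
  by exists c; [move: cab; rewrite in_itv | exact: e].
have [ut|/ltW tu] := leP (u ord0 p) t.
  have [||c /andP[c1 c2] e] := main (u ord0 p) t _ _ ut; [lra|lra|].
  rewrite set_coord_id in e; exists c; split; last by split; [lra|exact: e].
  by rewrite !ger0_norm ?subr_ge0// lerD2r.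
have [||c /andP[c1 c2] e] := main t (u ord0 p) _ _ tu; [lra|lra|].
rewrite set_coord_id in e; exists c; split; last first.
  split; first by lra.
  by rewrite -opprB e -mulrN opprB.
by rewrite distrC [leRHS]distrC !ger0_norm ?subr_ge0//; lra.
Qed.

End copula_facts.

(** * A seminorm measuring the distance to the limit space *)

Section uniform_continuity.
Context {R : realType} {d : nat}.

(** The second point ranges over all of [A]: partial derivatives are continuous on a
    set that is not compact, and only one of the points compared is kept away from
    its boundary. *)
Lemma uniformly_continuous_within (A K : set 'rV[R]_d) (f : 'rV[R]_d -> R) :
  compact K -> K `<=` A -> {within A, continuous f} ->
  forall e : R, 0 < e -> exists2 r : R, 0 < r & forall u v : 'rV[R]_d, K u -> A v ->
    (forall q, `|u ord0 q - v ord0 q| < r) -> `|f u - f v| <= e.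
Proof.
move=> /compact_near_coveringP/near_covering_withinP cK KA /subspace_continuousP cf e e0.
pose P (r : R) (u : 'rV[R]_d) := forall v : 'rV[R]_d, A v -> (forall q, `|u ord0 q - v ord0 q| < r) ->
  `|f u - f v| <= e.
have nearP : \forall r \near 0^'+, 0 < r /\ (K `<=` P r).
  near=> r; split; first by near: r; exact: nbhs_right_gt.
  near: r; apply: cK => x Kx.
  have /cvgrPdist_lt/(_ _ (divr_gt0 e0 (ltr0Sn _ 1))) := cf x (KA _ Kx).
  rewrite near_withinE => /nbhs_ballP[r /= r0 hr].
  have r20 : 0 < r / 2 by rewrite divr_gt0.
  have sP : \forall s \near 0^'+, 0 < s < r / 2.
    near=> s; apply/andP; split; near: s; first exact: nbhs_right_gt.
    exact: nbhs_right_lt.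
  exists (ball x (r / 2), [set s | 0 < s < r / 2]); first split => /=.
  - exact: nbhsx_ballx.
  - exact: sP.
  move=> [y s] [/= xy /andP[s0 sr]] Ky v Av yv.
  have xv : ball x r v.
    rewrite [r]splitr; apply: ball_triangle xy _; split; first by rewrite divr_gt0.
    by move=> i q; rewrite (ord1 i); exact: lt_trans (yv q) sr.
  have xy' : ball x r y by apply: le_ball xy; lra.
  have h2 := hr _ xv Av; have h1 := hr _ xy' (KA _ Ky).
  rewrite -(subrKA (f x)) [e]splitr.
  by apply: le_trans (ler_normD _ _) _; rewrite lerD// ?ltW// distrC.
have [r [r0 rP]] := @filter_ex _ _ _ _ nearP.
by exists r => // u v Ku; exact: rP.
Unshelve. all: by end_near. Qed.

Lemma compact_box (a b : 'I_d -> R) :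
  compact [set u : 'rV[R]_d | forall q, a q <= u ord0 q <= b q].
Proof.
rewrite (_ : mkset _ = [set u : 'rV[R]_d | forall q, `[a q, b q]%classic (u ord0 q)]).
  apply: (@rV_compact R d (fun q => `[a q, b q]%classic)) => q.
  exact: segment_compact.
by apply/seteqP; split => u /= h q; have := h q; rewrite /= in_itv.
Qed.

End uniform_continuity.

Section gauge.
Context {R : realType} {d : nat}.
Notation cube := (cube R d).
Notation linf := (linfty R cube).
Implicit Types (z : linf) (u v : cube) (k : nat).

Definition edge u :=
  (forall p, val u ord0 p = 1) \/ (exists p, val u ord0 p = 0).

(** The three kinds of evaluations whose smallness expresses that [z] is nearly
    continuous, nearly vanishes on the edge, and is bounded. The factor in the last
    kind makes it small on every fixed [z] as [k] grows. *)
Definition probes k : set (linf -> R) := [set l |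
  [\/ exists u v, (forall p, `|val u ord0 p - val v ord0 p| < k.+1%:R^-1) /\
        l = fun z => z u - z v,
      exists u, edge u /\ l = fun z => z u |
      exists u, l = fun z => k.+1%:R^-1 * z u]].

Definition gauge k z : R := sup [set `|l z| | l in probes k].

Lemma linftyDE z z' u : (z + z') u = z u + z' u. Proof. by []. Qed.
Lemma linftyBE z z' u : (z - z') u = z u - z' u. Proof. by []. Qed.
Lemma linfty_normE z : `|z| = linfty_norm z. Proof. by []. Qed.

Lemma probesD k l z z' : probes k l -> l (z + z') = l z + l z'.
Proof.
by move=> [[u [v [_ ->]]]|[u [_ ->]]|[u ->]]; rewrite !linftyDE ?mulrDr// opprD addrACA.
Qed.

Lemma probes_bound k l z : probes k l -> `|l z| <= 2 * `|z|.
Proof.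
have zu u : `|z u| <= `|z| by rewrite linfty_normE linfty_norm_ge.
move=> [[u [v [_ ->]]]|[u [_ ->]]|[u ->]].
- by apply: le_trans (ler_normB _ _) _; rewrite mulr_natl mulr2n lerD.
- by apply: le_trans (zu _) _; rewrite mulr_natl mulr2n lerDl.
- rewrite normrM; apply: (@le_trans _ _ (1 * `|z|)); last by rewrite ler_wpM2r// ler1n.
  by rewrite ler_pM// ger0_norm ?invr_ge0// invf_le1// ler1n.
Qed.

Lemma gauge_has_ubound k z : has_ubound [set `|l z| | l in probes k].
Proof. by exists (2 * `|z|) => _ [l kl <-]; exact: probes_bound kl. Qed.

Lemma gauge_ge k z l : probes k l -> `|l z| <= gauge k z.
Proof. by move=> kl; apply: ub_le_sup; [exact: gauge_has_ubound|exists l]. Qed.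

Lemma gauge_le k z c : 0 <= c -> (forall l, probes k l -> `|l z| <= c) ->
  gauge k z <= c.
Proof.
move=> c0 h; rewrite /gauge; set S := [set _ | _ in _].
have [->|/set0P ne] := eqVneq S set0; first by rewrite sup0.
by apply: ge_sup => // _ [l kl <-]; exact: h.
Qed.

Lemma gauge_ge0 k z : 0 <= gauge k z.
Proof.
rewrite /gauge; set S := [set _ | _ in _].
have [->|/set0P[_ [l kl _]]] := eqVneq S set0; first by rewrite sup0.
by apply: le_trans (gauge_ge z kl).
Qed.

Lemma gaugeD k z z' : gauge k (z + z') <= gauge k z + gauge k z'.
Proof.
apply: gauge_le => [|l kl]; first by rewrite addr_ge0 ?gauge_ge0.
rewrite (probesD _ _ kl); apply: le_trans (ler_normD _ _) _.
by rewrite lerD// gauge_ge.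
Qed.

Lemma gauge_le_norm k z : gauge k z <= 2 * `|z|.
Proof. by apply: gauge_le => [|l kl]; [rewrite mulr_ge0|exact: probes_bound kl]. Qed.

Lemma gauge_lip k z z' : `|gauge k z - gauge k z'| <= 2 * `|z - z'|.
Proof.
rewrite ler_norml; apply/andP; split.
  rewrite lerBrDr addrC lerBlDr; have := gaugeD k z (z' - z).
  rewrite addrC subrK => /le_trans; apply; rewrite lerD2l -(distrC z').
  exact: gauge_le_norm.
rewrite lerBlDr; have := gaugeD k (z - z') z'.
by rewrite subrK => /le_trans; apply; rewrite lerD2r gauge_le_norm.
Qed.

Lemma gauge_close k z u v :
  (forall p, `|val u ord0 p - val v ord0 p| < k.+1%:R^-1) ->
  `|z u - z v| <= gauge k z.
Proof. by move=> h; apply: (@gauge_ge k z (fun z => z u - z v)); apply: Or31; exists u, v. Qed.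

Lemma gauge_edge k z u : edge u -> `|z u| <= gauge k z.
Proof. by move=> h; apply: (@gauge_ge k z (fun z => z u)); apply: Or32; exists u. Qed.

Lemma gauge_norm k z u : `|z u| <= k.+1%:R * gauge k z.
Proof.
have := @gauge_ge k z (fun z => k.+1%:R^-1 * z u) ltac:(by apply: Or33; exists u).
by rewrite normrM ger0_norm ?invr_ge0// ler_pdivrMl ?ltr0Sn.
Qed.

(** The three kinds of probes are small by uniform continuity on the cube, by the
    boundary conditions, and by boundedness of [z]. *)
Lemma gauge_D0 z : D0 z -> gauge k z @[k --> \oo] --> 0.
Proof.
move=> [cz z1 z0]; apply/cvgrPdist_le => /= e e0.
pose f := valL_ (0 : R) (z : cube -> R).
have fE u : f (val u) = z u by rewrite /f -[in RHS](@valLK _ _ 0 _ (z : cube -> R)).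
have cf : {within cube, continuous f} by apply/subspace_valL_continuousP'.
have cK : compact cube by exact: (@compact_box R d (fun=> 0) (fun=> 1)).
have [r r0 hr] := uniformly_continuous_within cK (@subset_refl _ _) cf e0.
near=> k; rewrite sub0r normrN ger0_norm ?gauge_ge0//.
have kr : k.+1%:R^-1 < r.
  near: k; have := near_infty_natSinv_lt (PosNum r0); exact.
apply: gauge_le; first exact: ltW.
move=> l [[u [v [uv ->]]]|[u [eu ->]]|[u ->]].
- rewrite -!fE; apply: hr; [exact: set_valP|exact: set_valP|].
  by move=> q; apply: lt_trans (uv q) kr.
- by have -> : z u = 0; [case: eu => [/z1|/z0]|rewrite normr0 ltW].
- rewrite normrM ger0_norm ?invr_ge0// ler_pdivrMl ?ltr0Sn//.
  apply: (@le_trans _ _ `|z|); first by rewrite linfty_normE linfty_norm_ge.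
  rewrite -ler_pdivrMr//; apply: (@le_trans _ _ k%:R); last by rewrite ler_nat.
  by near: k; exact: nbhs_infty_ger.
Unshelve. all: by end_near. Qed.

(** The constant 2 is the Lipschitz constant of the gauge. *)
Definition gauge_test k z : R := Num.min 1 (gauge k z / 2).

Lemma gauge_test_ge0 k z : 0 <= gauge_test k z.
Proof. by rewrite le_min ler01 divr_ge0// gauge_ge0. Qed.

Lemma gauge_test_BL1 k : BL1 (gauge_test k).
Proof.
split=> [z|z z']; first by rewrite ger0_norm ?gauge_test_ge0// ge_min lexx.
have : `|gauge k z / 2 - gauge k z' / 2| <= `|z - z'|.
  by rewrite -mulrBl normrM (ger0_norm (_ : 0 <= 2^-1)) ?ler_pdivrMr 1?mulrC// gauge_lip.
rewrite /gauge_test; set a := gauge k z / 2; set b := gauge k z' / 2 => h.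
apply: le_trans h; rewrite /Order.min; case: ltP => ha; case: ltP => hb.
- by rewrite subrr normr0.
- by rewrite ger0_norm ?ger0_norm; lra.
- by rewrite ler0_norm ?ler0_norm; lra.
- by [].
Qed.

Lemma gauge_test_D0 z : D0 z -> gauge_test k z @[k --> \oo] --> 0.
Proof.
move=> hz; apply: (@squeeze_cvgr _ _ _ _ (fun=> 0) (fun k => gauge k z / 2)).
- near=> k; by rewrite gauge_test_ge0 ge_min lexx orbT.
- exact: cvg_cst.
- by rewrite -(mul0r (2^-1 : R)); apply: cvgMl; exact: gauge_D0.
Unshelve. all: by end_near. Qed.

(** Makes the event that the limit lies in [D0] measurable. *)
Lemma D0_closed : closed (D0 : set linf).
Proof.
move=> z clz.
have near_z (e : R) : 0 < e -> exists2 a : linf, D0 a & forall u, `|z u - a u| < e.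
  move=> e0; have [a [Da az]] := clz _ (nbhsx_ballx z e e0); exists a => // u.
  apply: le_lt_trans (_ : `|z - a| < e); first by rewrite linfty_normE -linftyBE linfty_norm_ge.
  by move: az; rewrite -ball_normE.
have zero u : (forall a : linf, D0 a -> a u = 0) -> z u = 0.
  move=> h; apply/eqP; rewrite -normr_le0; apply/ler_addgt0Pr => e /near_z[a Da za].
  by rewrite add0r; have := za u; rewrite (h _ Da) subr0 => /ltW.
split=> [u|u hu|u hu]; last 2 first.
- by apply: zero => a [_ /(_ u hu)].
- by apply: zero => a [_ _ /(_ u hu)].
have FF : Filter (nbhs u) := nbhs_filter u.
apply/(@cvgrPdist_lt _ _ _ _ FF) => /= e e0; have e3 : 0 < e / 3 by rewrite divr_gt0.
have [a [ca _ _] za] := near_z _ e3.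
have /(@cvgrPdist_lt _ _ _ _ FF)/(_ _ e3) := ca u; apply: filterS => v /= auv.
have := za u; have := za v; rewrite distrC => h1 h2.
have -> : z u - z v = (z u - a u) + (a u - a v) + (a v - z v) by ring.
rewrite (_ : e = e / 3 + e / 3 + e / 3); last by field.
apply: le_lt_trans (ler_normD _ _) _; apply: ltrD => //.
by apply: le_lt_trans (ler_normD _ _) _; apply: ltrD.
Qed.

End gauge.

(** * Weighted samples and their quantiles *)

Section weights.
Context {R : realType} {n : nat}.
Implicit Types (m : n.-tuple R) (A B : pred 'I_n) (a : 'I_n -> R).

Definition is_weight m :=
  (forall i, 0 <= tnth m i) /\ \sum_(i < n) tnth m i = n%:R.

Definition wt m A : R := n%:R^-1 * \sum_(i < n) tnth m i * (A i)%:R.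

Lemma wt_sub m A B : is_weight m -> (forall i, A i -> B i) -> wt m A <= wt m B.
Proof.
move=> [m0 _] AB; rewrite ler_wpM2l// ler_sum// => i _; rewrite ler_wpM2l//.
by have := AB i => h; case: (A i) h => // ->.
Qed.

Lemma wt_ge0 m A : is_weight m -> 0 <= wt m A.
Proof. by move=> [m0 _]; rewrite mulr_ge0// sumr_ge0// => i _; rewrite mulr_ge0. Qed.

Lemma wtU m A B : is_weight m -> wt m (predU A B) <= wt m A + wt m B.
Proof.
move=> [m0 _]; rewrite -mulrDr ler_wpM2l// -big_split/= ler_sum// => i _.
by rewrite -mulrDr ler_wpM2l// -natrD ler_nat; case: (A i); case: (B i).
Qed.

Lemma wt_disjoint m A B (D : pred 'I_n) : is_weight m -> (forall i, A i -> D i) ->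
  (forall i, B i -> D i) -> (forall i, A i -> ~~ B i) ->
  wt m A + wt m B <= wt m D.
Proof.
move=> [m0 _] AD BD AB; rewrite -mulrDr ler_wpM2l// -big_split/= ler_sum// => i _.
rewrite -mulrDr ler_wpM2l// -natrD ler_nat.
have := AD i; have := BD i; have := AB i.
case: (A i); case: (B i) => //=; last by move=> _ /(_ isT) ->.
- by move=> /(_ isT).
- by move=> _ _ /(_ isT) ->.
Qed.

Lemma wt_bigU d (B : 'I_d -> pred 'I_n) m : is_weight m ->
  wt m (fun i => [exists p, B p i]) <= \sum_(p < d) wt m (B p).
Proof.
move=> [m0 _]; rewrite -mulr_sumr ler_wpM2l// exchange_big/= ler_sum// => i _.
rewrite -mulr_sumr ler_wpM2l//; case: existsP => [[p Bpi]|_]; last by rewrite sumr_ge0.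
by rewrite (bigD1 p)//= Bpi lerDl sumr_ge0.
Qed.

Lemma wt0 m A : (forall i, A i = false) -> wt m A = 0.
Proof. by move=> h; rewrite /wt big1 ?mulr0// => i _; rewrite h mulr0. Qed.

Lemma wt1 m A : is_weight m -> (0 < n)%N -> (forall i, A i) -> wt m A = 1.
Proof.
move=> [_ m1] n0 h; rewrite /wt; under eq_bigr do rewrite h mulr1.
by rewrite m1 mulVf// pnatr_eq0 -lt0n.
Qed.

(** Distribution functions of finite samples are step functions: below (and, in
    [gap_above], above) any level there is an interval free of sample points. *)
Lemma gap_below a t : exists2 s, s < t & forall i, a i < t -> a i <= s.
Proof.
exists (\big[Num.max/t - 1]_(i | a i < t) a i) => [|i ait].
  by rewrite bigmax_lt//; rewrite ltrBlDr ltrDl.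
by rewrite le_bigmax_cond.
Qed.

Lemma gap_above a t : exists2 s, t < s & forall i, t < a i -> s <= a i.
Proof.
exists (\big[Num.min/t + 1]_(i | t < a i) a i) => [|i ait].
  by apply: lt_bigmin => //; rewrite ltrDl.
by rewrite bigmin_le_cond.
Qed.

Let df m a t := wt m (fun i => a i <= t).

(** The defining bracket of a quantile, also for the special convention at 0:
    the mass strictly below it is at most [q], the mass up to it at least [q]. *)
Lemma ginv_bracket m a q (t := ginv (df m a) q) :
  is_weight m -> (0 < n)%N -> 0 <= q <= 1 ->
  wt m (fun i => a i < t) <= q <= wt m (fun i => a i <= t).
Proof.
move=> wm n0 /andP[q0 q1].
pose top : R := \big[Num.max/0]_i a i; pose bot : R := \big[Num.min/0]_i a i.
have a_top i : a i <= top by exact: le_bigmax.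
have a_bot i : bot <= a i by exact: bigmin_le.
have df_mono s r : s <= r -> df m a s <= df m a r.
  by move=> sr; apply: wt_sub => // i /le_trans; apply.
have df_top s : top <= s -> df m a s = 1.
  by move=> ts; apply: wt1 => // i; exact: le_trans (a_top i) ts.
have df_bot s : s < bot -> df m a s = 0.
  by move=> sb; apply: wt0 => i; apply/negbTE; rewrite -ltNge; exact: lt_le_trans (a_bot i).
suff [lo hi] : (forall s, s < t -> df m a s <= q) /\ q <= df m a t.
  rewrite hi andbT; have [s st hs] := gap_below a t.
  apply: le_trans (lo s st); apply: wt_sub => // i; exact: hs.
rewrite /t /ginv; case: ifPn => [qp|]; last first.
  rewrite -leNgt => qn; have -> : q = 0 by apply/eqP; rewrite eq_le qn q0.
  split; last exact: wt_ge0.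
  have ne : [set r | df m a r = 0] !=set0.
    by exists (bot - 1); apply: df_bot; rewrite ltrBlDr ltrDl.
  move=> s /(sup_gt ne)[r /= dr sr]; rewrite -dr; exact: df_mono (ltW sr).
set S := [set r | q <= _].
have hS : has_inf S.
  split; first by exists top; rewrite /S /= df_top.
  exists bot => r /= dr; rewrite leNgt; apply/negP => /df_bot r0.
  have : q <= df m a r by exact: dr.
  by rewrite r0 leNgt qp.
split=> [s sS|].
  rewrite leNgt; apply/negP => /ltW qs.
  have := ge_inf hS.2 qs; by rewrite leNgt sS.
have [s ts hs] := gap_above a (inf S).
have [r Sr rs] := inf_lt hS.1 ts.
apply: le_trans Sr _; apply: wt_sub => // i air.
rewrite leNgt; apply/negP => /hs; rewrite leNgt => /negP; apply.
exact: le_lt_trans air rs.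
Qed.

End weights.

(** * First-order expansion of the copula of a weighted sample *)

Section expansion.
Context {R : realType} {d : nat}.
Notation cube := (cube R d).
Variables (F : 'I_d -> R -> R) (C : 'rV[R]_d -> R).
Hypothesis F_homo : forall p, {homo F p : s t / s <= t}.
Hypothesis F01 : forall p t, 0 <= F p t <= 1.
Hypothesis copC : is_copula C.

Definition in_cube (v : 'rV[R]_d) (hv : Defs.cube R d v) : cube := SigSub (mem_set hv).

Lemma cubeP (u : cube) : Defs.cube R d (val u). Proof. exact: set_valP. Qed.

(** A fixed sample with weights [m]; [b] is sqrt n times the deviation of the
    weighted distribution function of the transformed sample from [C]. Unit weights
    give the empirical copula, bootstrap weights the bootstrap copula. *)
Section fixed_weights.
Variables (n : nat) (x : n.-tuple (d.-tuple R)) (m : n.-tuple R).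
Hypotheses (n_gt0 : (0 < n)%N) (wm : is_weight m).
Let X i p := tnth (tnth x i) p.
Let U i p := F p (X i p).
Let rn : R := Num.sqrt n%:R.
Variables (b : linfty R cube) (k : nat) (g : R).
Hypothesis bE :
  forall u : cube, b u = rn * (bedf (unif_sample F x) m (val u) - C (val u)).
Hypothesis gauge_b : gauge k b <= g.

Let rn_gt0 : 0 < rn. Proof. by rewrite sqrtr_gt0 ltr0n. Qed.
Let g_ge0 : 0 <= g. Proof. exact: le_trans (gauge_ge0 _ _) gauge_b. Qed.

Lemma bedf_unifE v : bedf (unif_sample F x) m v =
  wt m (fun i => [forall p, U i p <= v ord0 p]).
Proof.
by rewrite /bedf /wt; congr (_ * _); apply: eq_bigr => i _; rewrite /le_vec;
  under eq_forallb do rewrite !tnth_mktuple.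
Qed.

Lemma bedf_cubeE (u : cube) :
  bedf (unif_sample F x) m (val u) = C (val u) + b u / rn.
Proof. by rewrite bE mulrC mulrA mulVf ?gt_eqF// mul1r addrC subrK. Qed.

(** The transformed sample lies in the cube, so that a marginal orthant constrains the
    p-th coordinate only. *)
Lemma margin_mass (u : cube) p : wt m (fun i => U i p <= val u ord0 p) =
  val u ord0 p + b (cube_margin u p) / rn.
Proof.
have /(_ _ _ (cubeP u)) mC := copC.2.
rewrite -{2}(mC p) -(bedf_cubeE (cube_margin u p)) bedf_unifE /=.
congr (_ * _); apply: eq_bigr => i _; congr (_ * _%:R); congr nat_of_bool.
apply/idP/forallP => [h q|/(_ p)]; rewrite !mxE ?eqxx//.
by case: eqP => [->|_] //; case/andP: (F01 q (X i q)).
Qed.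

(** The mass at [s > 0] is at most the increment of the margin over a short interval
    ending at [s]; the identity contributes an arbitrarily small amount and [b] at
    most its oscillation. At [s = 0] there is no such interval, but there [b]
    vanishes up to [g], being evaluated at an edge point. *)
Lemma atom_mass (u : cube) p : wt m (fun i => U i p == val u ord0 p) <= g / rn.
Proof.
have /andP[u0 u1] := cubeP u p; set s := val u ord0 p in u0 u1 *.
have [s0|sn0] := eqVneq s 0.
  have ed : edge (cube_margin u p).
    by right; exists p; rewrite /= mxE eqxx.
  apply: (@le_trans _ _ (wt m (fun i => U i p <= s))).
    by apply: wt_sub => // i /eqP ->.
  rewrite margin_mass -/s s0 add0r ler_pM2r ?invr_gt0//.
  apply: le_trans (ler_norm _) _; exact: le_trans (gauge_edge k b ed) gauge_b.
have s_gt0 : 0 < s by rewrite lt_neqAle eq_sym sn0.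
apply/ler_addgt0Pr => e e0.
have ik0 : 0 < k.+1%:R^-1 / 2 :> R by rewrite divr_gt0// invr_gt0.
(* The step back from [s] stays in the cube, is below the tolerance [e] and below
   the scale of the gauge. *)
pose h := Num.min s (Num.min e (k.+1%:R^-1 / 2)).
have h0 : 0 < h by rewrite !lt_min s_gt0 e0 ik0.
have hs : h <= s by rewrite ge_min lexx.
have he : h <= e by rewrite !ge_min lexx ?orbT.
have hk : h < k.+1%:R^-1.
  apply: (@le_lt_trans _ _ (k.+1%:R^-1 / 2)); first by rewrite !ge_min lexx ?orbT.
  by rewrite ltr_pdivrMr// ltr_pMr ?invr_gt0// ltr1n.
have cv : Defs.cube R d (set_coord (val u) p (s - h)).
  by apply: cube_set_coord; [exact: cubeP|rewrite subr_ge0 hs; lra].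
pose v := in_cube cv.
have vp : val v ord0 p = s - h by rewrite /= set_coordE.
apply: (@le_trans _ _ (wt m (fun i => U i p <= s) -
                       wt m (fun i => U i p <= val v ord0 p))).
  rewrite lerBrDr; apply: wt_disjoint => // i.
  - by move=> /eqP ->.
  - by rewrite vp => /le_trans; apply; rewrite gerBl ltW.
  - by move=> /eqP ->; rewrite vp -ltNge ltrBlDr ltrDl.
rewrite !margin_mass vp -/s.
have : `|b (cube_margin u p) - b (cube_margin v p)| <= g.
  apply: (le_trans _ gauge_b); apply: gauge_close => q /=; rewrite !mxE.
  case: eqP => [_|_]; last by rewrite subrr normr0 invr_gt0.
  by rewrite eqxx opprB addrCA subrr addr0 gtr0_norm.
move=> /ler_normlW; rewrite -(ler_pM2r (_ : 0 < rn^-1)) ?invr_gt0// mulrBl; lra.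
Qed.

Variable u : cube.
(* [t] is the quantile of the sample itself and [s] its image under the marginal
   distribution functions, a near-quantile of the transformed sample. *)
Let t p := ginv (bedf_marg x m p) (val u ord0 p).
Let s : 'rV[R]_d := \row_p F p (t p).

Let cube_s : Defs.cube R d s.
Proof. by move=> p; rewrite mxE. Qed.

Let sc : cube := in_cube cube_s.

Let sE p : s ord0 p = F p (t p). Proof. by rewrite mxE. Qed.

(** The transformation may merge sample points, so monotonicity alone determines the
    side on which a point lies only off the atom at [s]. *)
Let below_atom p i : U i p <= s ord0 p ->
  (X i p < t p) || (U i p == s ord0 p).
Proof.
rewrite sE => h; case: ltP => //= /(F_homo p) h'.
by rewrite eq_le h h'.
Qed.

(** The quantile bracket loses at most one atom when it is transported to the
    transformed sample. *)
Lemma quantile_approx p :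
  `|s ord0 p - val u ord0 p + b (cube_margin sc p) / rn| <= g / rn.
Proof.
have /andP[lo hi] : wt m (fun i => X i p < t p) <= val u ord0 p <=
    wt m (fun i => X i p <= t p).
  by have := @ginv_bracket R n m (fun i => X i p) _ wm n_gt0 (cubeP u p).
have h1 : wt m (fun i => X i p <= t p) <= wt m (fun i => U i p <= s ord0 p).
  by apply: wt_sub => // i h; rewrite sE; exact: F_homo.
have h2 : wt m (fun i => U i p <= s ord0 p) <=
    wt m (fun i => X i p < t p) + wt m (fun i => U i p == s ord0 p).
  by apply: le_trans (wtU _ _ wm); apply: wt_sub => // i; exact: below_atom.
have h3 := atom_mass sc p.
have := margin_mass sc p; rewrite /= => mm; rewrite mm in h1 h2.
rewrite /= in h3.
by rewrite ler_norml; apply/andP; split; lra.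
Qed.

Lemma boot_copula_approx : `|boot_copula x m (val u) -
  bedf (unif_sample F x) m s| <= d%:R * (g / rn).
Proof.
have -> : boot_copula x m (val u) = wt m (fun i => [forall p, X i p <= t p]).
  rewrite /boot_copula /bedf /wt; congr (_ * _); apply: eq_bigr => i _.
  by rewrite /le_vec; under eq_forallb do rewrite mxE.
rewrite bedf_unifE.
have h1 : wt m (fun i => [forall p, X i p <= t p]) <=
    wt m (fun i => [forall p, U i p <= s ord0 p]).
  apply: wt_sub => // i /forallP h; apply/forallP => p; rewrite sE.
  exact: F_homo.
rewrite distrC ger0_norm ?subr_ge0// lerBlDl.
apply: le_trans (_ : _ <= wt m (predU (fun i => [forall p, X i p <= t p])
   (fun i => [exists p, U i p == s ord0 p]))) _.
  apply: wt_sub => // i /forallP h /=.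
  case: (boolP [exists p, U i p == s ord0 p]) => [|/existsPn nU]; first by rewrite orbT.
  rewrite orbF; apply/forallP => p; have := below_atom (h p).
  by rewrite (negbTE (nU p)) orbF => /ltW.
apply: le_trans (wtU _ _ wm) _; rewrite lerD2l.
apply: le_trans (wt_bigU _ wm) _.
rewrite -[d%:R]/(d%:R) mulr_natl -[X in _ *+ X]card_ord -sumr_const.
by apply: ler_sum => p _; have := atom_mass sc p.
Qed.

Hypothesis C_derivable : forall p v, Defs.cube R d v -> 0 < v ord0 p < 1 ->
  has_pderive C p v.
(* Coordinates within [a] of 0 or 1 are within the scale of the gauge of the edge;
   the others are at least [a], hence [r], away from 0 and 1. *)
Let a : R := k.+1%:R^-1 / 2.
Variable r : R.
Hypothesis r_gt0 : 0 < r.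
Hypothesis ra : r <= a.
Hypothesis pderive_osc : forall p v w, Defs.cube R d v -> Defs.cube R d w ->
  a <= v ord0 p <= 1 - a -> 0 < w ord0 p < 1 ->
  (forall q, `|v ord0 q - w ord0 q| < r) ->
  `|pderive C p v - pderive C p w| <= k.+1%:R^-1.
(* sqrt n must exceed the bound (k + 2) g / r: the deviation [b] is at most (k + 1) g
   by the gauge, and an atom adds [g]. *)
Hypothesis n_large : k.+2%:R * g < r * rn.

Let a_gt0 : 0 < a. Proof. by rewrite divr_gt0// invr_gt0. Qed.
Let a_lt : a < k.+1%:R^-1.
Proof. by rewrite ltr_pdivrMr// ltr_pMr ?invr_gt0// ltr1n. Qed.
Let rnV_ge0 : 0 <= rn^-1. Proof. by rewrite invr_ge0 ltW. Qed.

Let bnorm v : `|b v| <= k.+1%:R * g.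
Proof. by apply: le_trans (gauge_norm k b v) _; rewrite ler_wpM2l. Qed.

Lemma quantile_close p : `|s ord0 p - val u ord0 p| < r.
Proof.
have h1 := quantile_approx p.
have h2 : `|b (cube_margin sc p) / rn| <= k.+1%:R * g / rn.
  by rewrite normrM (ger0_norm rnV_ge0) ler_wpM2r.
have h3 : g / rn + k.+1%:R * g / rn < r.
  by rewrite -mulrDl ltr_pdivrMr// -{1}[g]mul1r -mulrDl nat1r.
move: h1 h2; rewrite !ler_norml ltr_norml => /andP[? ?] /andP[? ?].
by apply/andP; split; lra.
Qed.

Let close_k (v : cube) : (forall p, `|val v ord0 p - val u ord0 p| < r) ->
  `|b v - b u| <= g.
Proof.
move=> h; apply: (le_trans _ gauge_b); apply: gauge_close => p.
by apply: lt_trans (h p) _; apply: le_lt_trans ra _.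
Qed.

(** The quantile moves by [- b(u^(p)) / sqrt n]: [b] was evaluated at [s], which is
    so close to [u] that replacing one by the other costs an oscillation. *)
Lemma quantile_shift p :
  `|rn * (s ord0 p - val u ord0 p) + b (cube_margin u p)| <= 2 * g.
Proof.
have h1 := quantile_approx p.
have h2 : `|b (cube_margin sc p) - b (cube_margin u p)| <= g.
  apply: (le_trans _ gauge_b); apply: gauge_close => q /=; rewrite !mxE.
  case: eqP => [_|_]; last by rewrite subrr normr0 invr_gt0.
  apply: lt_trans (_ : _ < r) _; last exact: le_lt_trans ra _.
  by have := quantile_close p; rewrite mxE.
have h3 : `|rn * (s ord0 p - val u ord0 p) + b (cube_margin sc p)| <= g.
  rewrite -(ler_pM2r (_ : 0 < rn^-1)) ?invr_gt0//.
  rewrite -[X in _ * X <= _](ger0_norm rnV_ge0) -normrM.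
  by rewrite mulrDl (mulrC rn) mulfK ?gt_eqF.
move: h2 h3; rewrite !ler_norml => /andP[? ?] /andP[? ?].
by apply/andP; split; lra.
Qed.

Let c p : 'rV[R]_d := corner (val u) s p.
Let cube_c p : Defs.cube R d (c p).
Proof. exact: cube_corner (cubeP u) cube_s. Qed.

(** In the interior, the mean value theorem and the uniform continuity of the partial
    derivative. Near the edge the partial derivative may jump, but [b(u^(p))] is at
    most 2 g there, hence so is the shift of the quantile up to a constant. *)
Lemma increment_approx (p : 'I_d) :
  `|rn * (C (set_coord (c p) p (s ord0 p)) - C (c p)) +
    pderive C p (val u) * b (cube_margin u p)| <= 6 * g.
Proof.
have hs := quantile_shift p; have hr := quantile_close p.
have /andP[d0 d1] := pderive_range copC C_derivable p (cubeP u).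
have [ua|] := boolP (a <= val u ord0 p <= 1 - a).
  have u01 : 0 < val u ord0 p < 1 by move: a_gt0 ua; lra.
  have s01 : 0 < s ord0 p < 1.
    by move: hr ra ua; rewrite ltr_norml => /andP[? ?] ? /andP[? ?]; apply/andP; split; lra.
  have cp : c p ord0 p = val u ord0 p by exact: corner_diag.
  have [y [ys [y01 ->]]] := @copula_MVT R d C C_derivable (c p) p (s ord0 p)
    (cube_c p) ltac:(by rewrite cp) s01.
  rewrite cp in ys *.
  set xi := set_coord (c p) p y.
  have cxi : Defs.cube R d xi by apply: cube_set_coord => //; lra.
  have xir q : `|val u ord0 q - xi ord0 q| < r.
    rewrite /xi !mxE; case: eqP => [->|_]; first by rewrite distrC; exact: le_lt_trans ys hr.
    case: ifP => _; last by rewrite subrr normr0.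
    by rewrite distrC; have := quantile_close q; rewrite mxE.
  have /andP[x0 x1] := pderive_range copC C_derivable p cxi.
  have osc := @pderive_osc p (val u) xi (cubeP u) cxi ua
     ltac:(by rewrite set_coordE) xir.
  have -> : rn * (pderive C p xi * (s ord0 p - val u ord0 p)) +
      pderive C p (val u) * b (cube_margin u p) =
    pderive C p xi * (rn * (s ord0 p - val u ord0 p) + b (cube_margin u p)) +
    (pderive C p (val u) - pderive C p xi) * b (cube_margin u p) by ring.
  apply: le_trans (ler_normD _ _) _.
  have h1 : `|pderive C p xi * (rn * (s ord0 p - val u ord0 p) +
      b (cube_margin u p))| <= 1 * (2 * g).
    by rewrite normrM ler_pM// ger0_norm.
  have h2 : `|(pderive C p (val u) - pderive C p xi) * b (cube_margin u p)| <=
      k.+1%:R^-1 * (k.+1%:R * g) by rewrite normrM ler_pM.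
  rewrite mulKf// in h2.
  by apply: le_trans (lerD h1 h2) _; move: g_ge0; lra.
move=> ua.
have bu : `|b (cube_margin u p)| <= 2 * g.
  (* The end of [0, 1] that the p-th coordinate is close to. *)
  pose e : R := if a <= val u ord0 p then 1 else 0.
  have ce : Defs.cube R d (set_coord (val u) p e).
    by apply: cube_set_coord (cubeP u) _; rewrite /e; case: ifP; rewrite lexx ler01.
  pose w := cube_margin (in_cube ce) p.
  have ew : edge w.
    rewrite /edge /w /= /e; case: ifP => _; [left => q|right; exists p].
      by rewrite !mxE eqxx; case: eqP.
    by rewrite !mxE eqxx.
  have h1 := le_trans (gauge_edge k b ew) gauge_b.
  have h2 : `|b (cube_margin u p) - b w| <= g.
    apply: (le_trans _ gauge_b); apply: gauge_close => q /=; rewrite !mxE eqxx.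
    case: eqP => [_|_]; last by rewrite subrr normr0 invr_gt0.
    have : `|val u ord0 p - e| < a; last by move=> /lt_trans; apply.
    move: ua; rewrite /e; have /andP[] := cubeP u p; set z := val u ord0 p.
    case: (leP a z) => /= [h ? ?|h ? ? _]; last by rewrite subr0 ger0_norm.
    by rewrite -ltNge distrC ger0_norm; lra.
  rewrite -[b (cube_margin u p)](subrK (b w)).
  by apply: le_trans (ler_normD _ _) _; lra.
have hl : `|rn * (C (set_coord (c p) p (s ord0 p)) - C (c p))| <= 4 * g.
  have h1 : `|rn * (s ord0 p - val u ord0 p)| <= 4 * g.
    rewrite -[rn * _](addrK (b (cube_margin u p))).
    by apply: le_trans (ler_normB _ _) _; lra.
  apply: le_trans h1; rewrite !normrM ler_wpM2l//.
  have := copula_lip1 copC p (cube_c p) (cube_s p).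
  by rewrite corner_diag.
apply: le_trans (ler_normD _ _) _.
have : `|pderive C p (val u) * b (cube_margin u p)| <= 1 * (2 * g).
  by rewrite normrM ler_pM// ger0_norm.
lra.
Qed.

(** The constant adds up d atoms, d increments of error at most 6 g, and one
    oscillation of [b]. *)
Lemma boot_copula_expansion :
  `|rn * (boot_copula x m (val u) - C (val u)) -
    (b u - \sum_(p < d) pderive C p (val u) * b (cube_margin u p))| <=
  (7 * d%:R + 1) * g.
Proof.
have h1 : `|rn * (boot_copula x m (val u) - bedf (unif_sample F x) m s)| <= d%:R * g.
  rewrite normrM (ger0_norm (ltW rn_gt0)) mulrC -ler_pdivlMr//.
  by apply: le_trans boot_copula_approx _; rewrite mulrA.
have h2 : `|b sc - b u| <= g by apply: close_k => p /=; exact: quantile_close.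
have h3 : `|\sum_(p < d) (rn * (C (set_coord (c p) p (s ord0 p)) - C (c p)) +
    pderive C p (val u) * b (cube_margin u p))| <= d%:R * (6 * g).
  apply: le_trans (ler_norm_sum _ _ _) _.
  rewrite mulr_natl -[X in _ *+ X]card_ord -sumr_const.
  by apply: ler_sum => p _; exact: increment_approx.
have h4 := bedf_cubeE sc; rewrite /= in h4.
rewrite big_split/= -mulr_sumr -(corner_telescope (val u) s C) in h3.
set S := \sum_(p < d) _ in h3 *.
have -> : rn * (boot_copula x m (val u) - C (val u)) - (b u - S) =
  rn * (boot_copula x m (val u) - bedf (unif_sample F x) m s) +
  (rn * (C s - C (val u)) + S) + (b sc - b u).
  have e : rn * (b sc / rn) = b sc by rewrite mulrC divfK// gt_eqF.
  by rewrite h4 !mulrBr mulrDr e; ring.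
rewrite (_ : (_ * g)%R = d%:R * g + d%:R * (6 * g) + g); last by ring.
apply: le_trans (ler_normD _ _) _; apply: lerD => //.
by apply: le_trans (ler_normD _ _) _; apply: lerD.
Qed.

End fixed_weights.
End expansion.

(** * The linearization error of the bootstrap copula *)

Section bounded_maps.
Context {R : realType}.

Lemma linfty_ofE (T : Type) (h : T -> R) c : (forall u, `|h u| <= c) ->
  forall u, linfty_of h u = h u.
Proof.
move=> hc u; have hb : h \in bddfun by apply/bddfunP; exists c.
by rewrite /linfty_of -[linfty_fun _]/(val _) insubdK.
Qed.

Lemma normr_linfty_le (T : Type) (z : linfty R T) c :
  0 <= c -> (forall u, `|z u| <= c) -> `|z| <= c.
Proof. exact: linfty_norm_le. Qed.

Lemma normr_linfty_ge (T : Type) (z : linfty R T) u : `|z u| <= `|z|.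
Proof. exact: linfty_norm_ge. Qed.

End bounded_maps.

Section derivative_map.
Context {R : realType} {d : nat}.
Notation cube := (cube R d).
Notation linf := (linfty R cube).
Variable C : 'rV[R]_d -> R.
Hypothesis copC : is_copula C.
Hypothesis C_derivable : forall p u, Defs.cube R d u -> 0 < u ord0 p < 1 ->
  has_pderive C p u.

Lemma copula_derivative_bound (a : linf) (u : cube) :
  `|a u - \sum_(p < d) pderive C p (val u) * a (cube_margin u p)| <=
  d.+1%:R * `|a|.
Proof.
apply: le_trans (ler_normB _ _) _.
rewrite -nat1r mulrDl mul1r lerD ?normr_linfty_ge//.
apply: le_trans (ler_norm_sum _ _ _) _.
rewrite mulr_natl -[X in _ *+ X]card_ord -sumr_const; apply: ler_sum => p _.
have /andP[p0 p1] := pderive_range copC C_derivable p (cubeP u).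
by rewrite normrM -[leRHS]mul1r ler_pM ?normr_linfty_ge// ger0_norm.
Qed.

Lemma copula_derivativeE (a : linf) (u : cube) : copula_derivative C a u =
  a u - \sum_(p < d) pderive C p (val u) * a (cube_margin u p).
Proof. exact: linfty_ofE (copula_derivative_bound a) u. Qed.

Lemma copula_derivative_lip (a b : linf) :
  `|copula_derivative C a - copula_derivative C b| <= d.+1%:R * `|a - b|.
Proof.
apply: normr_linfty_le => [|u]; first by rewrite mulr_ge0.
apply: le_trans (copula_derivative_bound (a - b) u).
have -> : \sum_(p < d) pderive C p (val u) * (a - b) (cube_margin u p) =
    \sum_(p < d) pderive C p (val u) * a (cube_margin u p) -
    \sum_(p < d) pderive C p (val u) * b (cube_margin u p).
  by rewrite -sumrB; apply: eq_bigr => p _; rewrite linftyBE mulrBr.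
rewrite !linftyBE !copula_derivativeE le_eqVlt; apply/orP; left.
by apply/eqP; congr (`|_|); ring.
Qed.

End derivative_map.

Section empirical_maps.
Context {R : realType} {d : nat}.
Notation cube := (cube R d).
Notation linf := (linfty R cube).
Implicit Types (F : 'I_d -> R -> R) (C : 'rV[R]_d -> R).

Definition ones n : n.-tuple R := [tuple 1 | i < n].

Lemma is_weight_ones n : is_weight (ones n).
Proof.
split=> [i|]; first by rewrite tnth_mktuple.
by under eq_bigr do rewrite tnth_mktuple; rewrite sumr_const card_ord.
Qed.

Section fixed_size.
Context {n : nat}.
Implicit Types (x : n.-tuple (d.-tuple R)) (m : n.-tuple R).

Lemma edf_ones x v : edf x v = bedf x (ones n) v.
Proof.
by congr (_ * _); apply: eq_bigr => i _; rewrite tnth_mktuple mul1r.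
Qed.

Lemma edf_marg_ones x p t : edf_marg x p t = bedf_marg x (ones n) p t.
Proof.
by congr (_ * _); apply: eq_bigr => i _; rewrite tnth_mktuple mul1r.
Qed.

Lemma emp_copula_ones x u : emp_copula x u = boot_copula x (ones n) u.
Proof.
rewrite /emp_copula /boot_copula edf_ones; congr bedf; apply/rowP => p.
by rewrite !mxE; congr ginv; apply/funext => t; exact: edf_marg_ones.
Qed.

Lemma bedf_bound x m v : `|bedf x m v| <= n%:R^-1 * \sum_(i < n) `|tnth m i|.
Proof.
rewrite normrM (ger0_norm (_ : 0 <= n%:R^-1))// ler_wpM2l//.
apply: le_trans (ler_norm_sum _ _ _) _; apply: ler_sum => i _.
by rewrite normrM ler_piMr//; case: le_vec; rewrite ?normr1 ?normr0.
Qed.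

Lemma scaled_diff_bound (c e f a b : R) : 0 <= c -> `|e| <= a -> `|f| <= b ->
  `|c * (e - f)| <= c * (a + b).
Proof.
move=> c0 ea fb; rewrite normrM ger0_norm// ler_wpM2l//.
by apply: le_trans (ler_normB _ _) _; exact: lerD.
Qed.

Lemma alphaE F C x (u : cube) : is_copula C -> alpha F C x u =
  Num.sqrt n%:R * (edf (unif_sample F x) (val u) - C (val u)).
Proof.
move=> copC; apply: linfty_ofE => v; apply: scaled_diff_bound.
- exact: sqrtr_ge0.
- by rewrite edf_ones; exact: bedf_bound.
- rewrite ger0_norm; first exact: (copula_le1 copC (cubeP v)).
  exact: (copula_ge0 copC (cubeP v)).
Qed.

Lemma alpha_bootE F x m (u : cube) : alpha_boot F x m u = Num.sqrt n%:R *
  (bedf (unif_sample F x) m (val u) - edf (unif_sample F x) (val u)).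
Proof.
apply: linfty_ofE => v; apply: scaled_diff_bound; first exact: sqrtr_ge0.
- exact: bedf_bound.
- by rewrite edf_ones; exact: bedf_bound.
Qed.

Lemma copula_bootE x m (u : cube) : copula_boot x m u = Num.sqrt n%:R *
  (boot_copula x m (val u) - emp_copula x (val u)).
Proof.
apply: linfty_ofE => v; apply: scaled_diff_bound; first exact: sqrtr_ge0.
- exact: bedf_bound.
- by rewrite emp_copula_ones; exact: bedf_bound.
Qed.

End fixed_size.

Variables (F : 'I_d -> R -> R) (C : 'rV[R]_d -> R).
Hypothesis F_homo : forall p, {homo F p : s t / s <= t}.
Hypothesis F01 : forall p t, 0 <= F p t <= 1.
Hypothesis copC : is_copula C.
Hypothesis C_derivable : forall p u, Defs.cube R d u -> 0 < u ord0 p < 1 ->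
  has_pderive C p u.
Hypothesis C_pderive_cont : forall p,
  {within [set u | Defs.cube R d u /\ 0 < u ord0 p < 1],
    continuous (pderive C p)}.

Lemma pderive_unif_cont (a e : R) : 0 < a -> 0 < e ->
  exists2 r : R, 0 < r & forall p (v w : 'rV[R]_d), Defs.cube R d v ->
    Defs.cube R d w -> a <= v ord0 p <= 1 - a -> 0 < w ord0 p < 1 ->
    (forall q, `|v ord0 q - w ord0 q| < r) ->
    `|pderive C p v - pderive C p w| <= e.
Proof.
move=> a0 e0.
have /choice[r hr] : forall p, exists r : R, 0 < r /\ forall v w : 'rV[R]_d,
    Defs.cube R d v -> Defs.cube R d w ->
    a <= v ord0 p <= 1 - a -> 0 < w ord0 p < 1 ->
    (forall q, `|v ord0 q - w ord0 q| < r) ->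
    `|pderive C p v - pderive C p w| <= e.
  move=> p; pose lo q : R := if q == p then a else 0.
  pose hi q : R := if q == p then 1 - a else 1.
  have cK := @compact_box R d lo hi; set K := [set _ | _] in cK.
  have KA : K `<=` [set u | Defs.cube R d u /\ 0 < u ord0 p < 1].
    move=> u Ku; have := Ku p; rewrite /lo /hi eqxx => up; split; last by lra.
    move=> q; have := Ku q; rewrite /lo /hi; case: eqP => [->|_] //; lra.
  have [r r0 hr] := uniformly_continuous_within cK KA (@C_pderive_cont p) e0.
  exists r; split=> // v w cv cw vp wp vw; apply: hr => // q.
  by rewrite /lo /hi; case: eqP => [->//|_]; exact: cv.
exists (\big[Num.min/1]_p r p).
  by apply: lt_bigmin => // p _; case: (hr p).
move=> p v w cv cw vp wp vw; apply: (hr p).2 => // q.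
by apply: lt_le_trans (vw q) _; exact: bigmin_le.
Qed.

(** The radius of uniform continuity depends on the scale [k] only, so that the
    sample size from which the expansion holds depends on [k] and [g] only. *)
Lemma boot_copula_expansion_eventually k (g : R) : exists N : nat,
  forall n (x : n.-tuple (d.-tuple R)) (m : n.-tuple R) (b : linf),
  (N <= n)%N -> is_weight m ->
  (forall u : cube, b u =
     Num.sqrt n%:R * (bedf (unif_sample F x) m (val u) - C (val u))) ->
  gauge k b <= g -> forall u : cube,
  `|Num.sqrt n%:R * (boot_copula x m (val u) - C (val u)) -
    copula_derivative C b u| <= (7 * d%:R + 1) * g.
Proof.
have k0 : 0 < k.+1%:R^-1 :> R by rewrite invr_gt0.
have a0 : 0 < k.+1%:R^-1 / 2 :> R by rewrite divr_gt0.
have [r0 r0_gt0 hr0] := pderive_unif_cont a0 k0.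
pose r := Num.min r0 (k.+1%:R^-1 / 2).
have r_gt0 : 0 < r by rewrite lt_min r0_gt0 a0.
pose L := k.+2%:R * g / r.
exists (Num.bound (L ^+ 2)).+1 => n x m b Nn wm bE gb u.
have n_gt0 : (0 < n)%N by exact: leq_trans Nn.
rewrite (copula_derivativeE copC C_derivable).
apply: (boot_copula_expansion F_homo F01 copC n_gt0 wm bE gb u C_derivable
  (r := r)) => //.
- by rewrite ge_min lexx orbT.
- move=> p v w cv cw vp wp vw; apply: hr0 => // q.
  by apply: lt_le_trans (vw q) _; rewrite ge_min lexx.
- rewrite [ltRHS]mulrC -ltr_pdivrMr//; apply: le_lt_trans (ler_norm _) _.
  rewrite -/L -sqrtr_sqr. 
  have := archi_boundP (sqr_ge0 L) => Lb.
  rewrite ltr_sqrt ?ltr0n//; apply: lt_le_trans Lb _.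
  by rewrite ler_nat; exact: leq_trans (leqnSn _) Nn.
Qed.

(** The expansion is applied to the bootstrap weights, with deviation
    [alpha + alpha_boot], and to unit weights, with deviation [alpha]; both have
    gauge at most [2 g], and [C] cancels in the difference. *)
Lemma remainder_eventually_small k (g : R) : exists N : nat,
  forall n (x : n.-tuple (d.-tuple R)) (m : n.-tuple R),
  (N <= n)%N -> is_weight m ->
  gauge k (alpha F C x) <= g -> gauge k (alpha_boot F x m) <= g ->
  `|copula_boot x m - copula_derivative C (alpha_boot F x m)| <=
  4 * (7 * d%:R + 1) * g.
Proof.
have [N hN] := boot_copula_expansion_eventually k (2 * g).
exists N => n x m Nn wm ga gb.
have g0 : 0 <= g by exact: le_trans (gauge_ge0 _ _) ga.
have c0 : 0 <= 7 * d%:R + 1 :> R by rewrite addr_ge0// mulr_ge0.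
apply: normr_linfty_le => [|u]; first by rewrite !mulr_ge0.
have h1 := hN n x (ones n) (alpha F C x) Nn (is_weight_ones n)
  (fun v => ltac:(by rewrite alphaE// edf_ones)) ltac:(lra) u.
have h2 := hN n x m (alpha F C x + alpha_boot F x m) Nn wm
  (fun v => ltac:(by rewrite linftyDE alphaE// alpha_bootE; ring))
  ltac:(by apply: le_trans (gaugeD _ _ _) _; lra) u.
have e : copula_boot x m u - copula_derivative C (alpha_boot F x m) u =
  (Num.sqrt n%:R * (boot_copula x m (val u) - C (val u)) -
    copula_derivative C (alpha F C x + alpha_boot F x m) u) -
  (Num.sqrt n%:R * (boot_copula x (ones n) (val u) - C (val u)) -
    copula_derivative C (alpha F C x) u).
  rewrite copula_bootE emp_copula_ones !(copula_derivativeE copC C_derivable).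
  rewrite linftyDE.
  under [X in _ = _ - (_ - X) - _]eq_bigr do rewrite linftyDE mulrDr.
  by rewrite big_split/=; ring.
rewrite linftyBE e.
apply: le_trans (ler_normB _ _) _.
apply: le_trans (lerD h2 h1) _; rewrite le_eqVlt; apply/orP; left; apply/eqP; ring.
Qed.

End empirical_maps.

(** * Means and outer means of bounded functions *)

Section bounded_measurable.
Context {R : realType} {dT} {T : measurableType dT}.
Implicit Types u v : T -> R.

Definition bounded_measurable u :=
  measurable_fun setT u /\ exists c, forall x, `|u x| <= c.

Lemma bounded_measurable_cst c : bounded_measurable (fun=> c).
Proof. by split; [exact: measurable_cst|exists `|c|]. Qed.

Lemma bounded_measurableD u v : bounded_measurable u -> bounded_measurable v ->
  bounded_measurable (fun x => u x + v x).
Proof.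
move=> [mu [a ha]] [mv [b hb]]; split; first exact: measurable_funD.
by exists (a + b) => x; apply: le_trans (ler_normD _ _) _; rewrite lerD.
Qed.

Lemma bounded_measurableZ c u : bounded_measurable u ->
  bounded_measurable (fun x => c * u x).
Proof.
move=> [mu [a ha]]; split; first exact: measurable_funM.
by exists (`|c| * a) => x; rewrite normrM ler_wpM2l.
Qed.

Lemma bounded_measurableB u v : bounded_measurable u -> bounded_measurable v ->
  bounded_measurable (fun x => u x - v x).
Proof.
move=> bu bv; have := bounded_measurableD bu (bounded_measurableZ (-1) bv).
by congr bounded_measurable; apply/funext => x; rewrite mulN1r.
Qed.

Lemma bounded_measurable_indic (A : set T) : measurable A ->
  bounded_measurable (\1_A : T -> R).
Proof.
move=> mA; split; first exact: measurable_indic.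
by exists 1 => x; rewrite indicE ger0_norm; case: (_ \in _).
Qed.

Section probability_measure.
Variable mu : {measure set T -> \bar R}.
Hypothesis mu1 : mu setT = 1%E.

Definition mean u : R := fine (\int[mu]_x (u x)%:E).

Lemma bounded_measurable_integrable u : bounded_measurable u ->
  mu.-integrable setT (EFin \o u).
Proof.
move=> [mu_ [c hc]]; apply: measurable_bounded_integrable => //.
  by rewrite mu1 ltry.
exists c; split; first exact: num_real.
by move=> y cy x _; apply: le_trans (hc x) (ltW cy).
Qed.

Lemma meanE u : bounded_measurable u -> (\int[mu]_x (u x)%:E)%E = (mean u)%:E.
Proof.
by move=> bu; rewrite fineK//; exact: integrable_fin_num (bounded_measurable_integrable bu).
Qed.

Lemma mean_le u v : bounded_measurable u -> bounded_measurable v ->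
  (forall x, u x <= v x) -> mean u <= mean v.
Proof.
move=> bu bv uv; rewrite -lee_fin -!meanE//; apply: le_integral => //.
- exact: bounded_measurable_integrable.
- exact: bounded_measurable_integrable.
- by move=> x _; rewrite lee_fin.
Qed.

Lemma meanD u v : bounded_measurable u -> bounded_measurable v ->
  mean (fun x => u x + v x) = mean u + mean v.
Proof.
move=> bu bv; apply: EFin_inj; rewrite EFinD -!meanE//; last exact: bounded_measurableD.
under eq_integral do rewrite EFinD.
by rewrite (integralD measurableT (bounded_measurable_integrable bu)
  (bounded_measurable_integrable bv)).
Qed.

Lemma meanZ c u : bounded_measurable u -> mean (fun x => c * u x) = c * mean u.
Proof.
move=> bu; apply: EFin_inj; rewrite EFinM -!meanE//; last exact: bounded_measurableZ.
under eq_integral do rewrite EFinM.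
by rewrite (integralZl measurableT (bounded_measurable_integrable bu)).
Qed.

Lemma meanB u v : bounded_measurable u -> bounded_measurable v ->
  mean (fun x => u x - v x) = mean u - mean v.
Proof.
move=> bu bv; rewrite -mulN1r -meanZ// -meanD//; last exact: bounded_measurableZ.
by congr mean; apply/funext => x; rewrite mulN1r.
Qed.

Lemma mean_cst c : mean (fun=> c) = c.
Proof. by rewrite /mean integral_cst// mu1 mule1. Qed.

Lemma mean_indic (A : set T) : measurable A -> mu A = (mean \1_A)%:E.
Proof.
move=> mA; rewrite -meanE; last exact: bounded_measurable_indic.
by rewrite integral_indic// setIT.
Qed.

Lemma mean_bound u (c : R) : bounded_measurable u -> (forall x, `|u x| <= c) ->
  `|mean u| <= c.
Proof.
move=> bu hc; rewrite ler_norml; apply/andP; split.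
  rewrite -[leLHS]mean_cst; apply: mean_le => //; first exact: bounded_measurable_cst.
  by move=> x; have := hc x; rewrite ler_norml => /andP[].
rewrite -[leRHS]mean_cst; apply: mean_le => //; first exact: bounded_measurable_cst.
by move=> x; have := hc x; rewrite ler_norml => /andP[].
Qed.

Lemma mean_ae_le u v : bounded_measurable u -> bounded_measurable v ->
  {ae mu, forall x, u x <= v x} -> mean u <= mean v.
Proof.
move=> bu bv [N [mN muN sub]].
have bN := bounded_measurable_indic mN.
have [c hc] : exists c, forall x, u x - v x <= c.
  have [_ [c hc]] := bounded_measurableB bu bv; exists c => x.
  by apply: le_trans (ler_norm _) (hc x).
have : mean u <= mean (fun x => v x + c * \1_N x).
  apply: mean_le => // [|x].
    by apply: bounded_measurableD => //; exact: bounded_measurableZ.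
  rewrite indicE; have [xN|xN] := boolP (x \in N).
    by rewrite mulr1 -lerBlDl.
  rewrite mulr0 addr0; apply: contrapT => h.
  exact: (negP xN (mem_set (sub x h))).
rewrite meanD ?meanZ//; last exact: bounded_measurableZ.
suff -> : mean \1_N = 0 by rewrite mulr0 addr0.
by apply: EFin_inj; rewrite -mean_indic// muN.
Qed.

Lemma mean_markov u (e : R) : bounded_measurable u -> (forall x, 0 <= u x) ->
  0 < e -> (mu [set x | (e <= u x)%R] <= (mean u / e)%:E)%E.
Proof.
move=> bu u0 e0.
have mA : measurable [set x | e <= u x].
  rewrite -[X in measurable X]setTI (_ : mkset _ = u @^-1` `[e, +oo[).
    by apply: bu.1.
  by apply/seteqP; split => x /=; rewrite in_itv/= andbT.
rewrite mean_indic// lee_fin ler_pdivlMr// mulrC -meanZ; last exact: bounded_measurable_indic.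
apply: mean_le => //; first exact/bounded_measurableZ/bounded_measurable_indic.
move=> x; rewrite indicE; case: (boolP (_ \in _)); rewrite ?mulr0// inE/= mulr1.
by [].
Qed.

Definition outer_mean h : R := fine (outer_integral mu h).

Lemma outer_meanE (h : T -> R) (c : R) : (forall x, `|h x| <= c) ->
  outer_integral mu h = (outer_mean h)%:E.
Proof.
move=> hc; rewrite fineK// fin_numE; apply/andP; split; last first.
  rewrite -ltey; apply: (@le_lt_trans _ _ c%:E); last exact: ltry.
  apply: ereal_inf_lbound; exists (fun=> c%:E); last by rewrite integral_cst// mu1 mule1.
  split; first exact: (bounded_measurable_integrable (bounded_measurable_cst c)).
  by move=> x; rewrite lee_fin; apply: le_trans (ler_norm _) (hc x).
rewrite -ltNye; apply: (@lt_le_trans _ _ (- c)%:E); first exact: ltNyr.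
apply: le_ereal_inf_tmp => _ [U [iU hU] <-].
have := integral_cst mu measurableT (- c)%:E; rewrite mu1 mule1 => <-.
apply: le_integral => //.
  exact: (bounded_measurable_integrable (bounded_measurable_cst (- c))).
move=> x _; apply: le_trans (hU x); rewrite lee_fin.
by have := hc x; rewrite ler_norml => /andP[].
Qed.

(** Outer integrals are not additive, but adding a measurable function to an upper
    bound gives an upper bound. *)
Lemma outer_mean_perturb (h k : T -> R) v (c : R) : (forall x, `|h x| <= c) ->
  (forall x, `|k x| <= c) -> bounded_measurable v ->
  (forall x, h x <= k x + v x) -> outer_mean h <= outer_mean k + mean v.
Proof.
move=> hc kc bv hkv; rewrite -lerBlDr -lee_fin -(outer_meanE kc).
apply: le_ereal_inf_tmp => _ [U [iU kU] <-].
have iv := bounded_measurable_integrable bv.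
rewrite EFinB leeBlDr// -(outer_meanE hc) -(meanE bv).
have := integralD measurableT iU iv; rewrite /= => <-.
apply: ereal_inf_lbound; exists (fun x => U x + (v x)%:E)%E => //.
split; first exact: (integrableD measurableT iU iv).
move=> x; apply: le_trans (leeD2r _ (kU x)).
by rewrite -EFinD lee_fin.
Qed.

Lemma mean_le_outer_mean (h : T -> R) u (c : R) : (forall x, `|h x| <= c) ->
  bounded_measurable u -> (forall x, u x <= h x) -> mean u <= outer_mean h.
Proof.
move=> hc bu hu; rewrite -lee_fin -(outer_meanE hc) -meanE//.
apply: le_ereal_inf_tmp => _ [U [iU hU] <-]; apply: le_integral => //.
  exact: bounded_measurable_integrable.
by move=> x _; apply: le_trans (hU x); rewrite lee_fin.
Qed.

Lemma outer_meanZ (h : T -> R) (a c : R) : (forall x, `|h x| <= c) -> 0 < a ->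
  outer_mean (fun x => a * h x) = a * outer_mean h.
Proof.
have half (k : T -> R) (b e : R) : (forall x, `|k x| <= e) -> 0 < b ->
    outer_mean (fun x => b * k x) <= b * outer_mean k.
  move=> ke b0; rewrite -ler_pdivrMl// -lee_fin -(outer_meanE ke).
  apply: le_ereal_inf_tmp => _ [U [iU kU] <-].
  have bke x : `|b * k x| <= b * e by rewrite normrM gtr0_norm// ler_wpM2l// ltW.
  rewrite EFinM lee_pdivrMl// -(outer_meanE bke) -(integralZl measurableT iU).
  apply: ereal_inf_lbound; exists (fun x => b%:E * U x)%E => //.
  split; first exact: (integrableZl measurableT b iU).
  by move=> x; rewrite EFinM lee_pmul2l.
move=> hc a0; apply/eqP; rewrite eq_le (half _ _ c)//=.
have ahc x : `|a * h x| <= a * c by rewrite normrM gtr0_norm// ler_wpM2l// ltW.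
rewrite -ler_pdivlMl// (le_trans _ (half _ _ (a * c) _ _)) ?invr_gt0//.
rewrite le_eqVlt; apply/orP; left; apply/eqP; congr outer_mean.
by apply/funext => x; rewrite mulKf// gt_eqF.
Qed.

End probability_measure.
End bounded_measurable.

(** * Measurable majorants of bounded functions *)

Section clip.
Context {R : realType}.

Definition clip (y : \bar R) : R := fine (maxe (-1)%:E (mine y 1%:E)).

Lemma EFin_clip y : (clip y)%:E = maxe (-1)%:E (mine y 1%:E).
Proof.
rewrite fineK// fin_numE; case: y => [y| |] /=.
- by rewrite -EFin_min -EFin_max.
- by rewrite (min_idPr (leey _)) -EFin_max.
- by rewrite (min_idPl (leNye _)) (max_idPl (leNye _)).
Qed.

Lemma clip_bound y : `|clip y| <= 1.
Proof.
by rewrite ler_norml -!lee_fin EFin_clip le_max lexx/= ge_max lee_fin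
  ge_min lexx orbT andbT; lra.
Qed.

Lemma clip_le y : ((-1)%:E <= y -> (clip y)%:E <= y)%E.
Proof. by move=> h; rewrite EFin_clip ge_max h ge_min lexx. Qed.

Lemma le_clip (r : R) y : r <= 1 -> (r%:E <= y)%E -> r <= clip y.
Proof. by move=> r1 ry; rewrite -lee_fin EFin_clip le_max le_min ry !lee_fin r1 orbT. Qed.

Lemma measurable_clip d (T : measurableType d) (U : T -> \bar R) :
  measurable_fun setT U -> measurable_fun setT (clip \o U).
Proof.
move=> mU; apply: (measurableT_comp (fine_measurable measurableT)).
apply: measurable_maxe; first exact: measurable_cst.
by apply: measurable_mine => //; exact: measurable_cst.
Qed.

Lemma bounded_measurable_clip d (T : measurableType d) (U : T -> \bar R) :
  measurable_fun setT U -> bounded_measurable (clip \o U).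
Proof.
by move=> mU; split; [exact: measurable_clip|exists 1 => x; exact: clip_bound].
Qed.

End clip.

Section majorants.
Context {R : realType} dT dS {T : measurableType dT} {S : measurableType dS}.
Variables (P : probability T R) (J : T -> S).
Hypothesis mJ : measurable_fun setT J.

Lemma bounded_measurable_comp (u : S -> R) : bounded_measurable u ->
  bounded_measurable (u \o J).
Proof.
by move=> [mu [c hc]]; split; [exact: measurableT_comp|exists c => x; exact: hc].
Qed.

Let P1 : P setT = 1%E. Proof. exact: probability_setT. Qed.

(** A majorant of a function bounded by 1 may take arbitrary values above 1 on a null
    set; truncation gives a bounded representative. *)
Lemma measurable_majorant_clip (h : S -> R) U : (forall z, `|h z| <= 1) ->
  measurable_majorant P J h U ->
  (forall z, h z <= clip (U z)) /\ {ae P, forall w, U (J w) = (clip (U (J w)))%:E}.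
Proof.
move=> h1 [mU hU minU].
have hle z : h z <= clip (U z).
  by apply: le_clip => //; apply: le_trans (ler_norm _) (h1 z).
split=> //; have mc : measurable_fun setT (fun z => (clip (U z))%:E).
  by apply/measurable_EFinP; exact: measurable_clip.
have := minU _ mc (fun z => ltac:(by rewrite lee_fin; exact: hle)).
apply: filterS => w /= Uc; apply/eqP; rewrite eq_le Uc/= clip_le//.
apply: le_trans (hU (J w)); rewrite lee_fin.
by have := h1 (J w); rewrite ler_norml => /andP[].
Qed.

(** A version of the measurable majorant: the infimum of a sequence of
    measurable upper bounds whose means tend to the least possible value. *)
Lemma measurable_majorant_exists (h : S -> R) : (forall z, `|h z| <= 1) ->
  exists u : S -> R, [/\ bounded_measurable u, forall z, `|u z| <= 1 &
    measurable_majorant P J h (EFin \o u)].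
Proof.
move=> h1.
pose A := [set v : S -> R | [/\ bounded_measurable v, forall z, `|v z| <= 1 &
  forall z, h z <= v z]].
pose M := [set mean P (v \o J) | v in A].
have A1 : A (fun=> 1).
  split; [exact: bounded_measurable_cst|by move=> z; rewrite normr1|].
  by move=> z; apply: le_trans (ler_norm _) (h1 z).
have hM : has_inf M.
  split; first by exists (mean P ((fun=> 1) \o J)); exists (fun=> 1).
  exists (-1) => _ [v [bv v1 _] <-].
  have := mean_bound P1 (bounded_measurable_comp bv) (fun w => v1 (J w)).
  by rewrite ler_norml => /andP[].
have /choice[v hv] (k : nat) : exists v, A v /\ mean P (v \o J) < inf M + k.+1%:R^-1.
  have [_ [v Av <-] lt] := inf_adherent (ltac:(by rewrite invr_gt0) : 0 < k.+1%:R^-1 :> R) hM.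
  by exists v.
pose u z := infs (v ^~ z) 0.
have lbv z : has_lbound (range (v ^~ z)).
  exists (-1) => _ [k _ <-]; have [[_ v1 _] _] := hv k.
  by have := v1 z; rewrite ler_norml => /andP[].
have u_le k z : u z <= v k z.
  apply: ge_inf; last by exists k.
  by have [l hl] := lbv z; exists l => _ [j _ <-]; apply: hl; exists j.
have le_u c z : (forall k, c <= v k z) -> c <= u z.
  move=> hc; apply: lb_le_inf; first by exists (v 0%N z); exists 0%N.
  by move=> _ [j _ <-]; exact: hc.
have hu z : h z <= u z by apply: le_u => k; have [[_ _ /(_ z)]] := hv k.
have u1 z : `|u z| <= 1.
  rewrite ler_norml; apply/andP; split.
    by apply: le_u => k; have [[_ /(_ z) + _] _] := hv k; rewrite ler_norml => /andP[].
  apply: le_trans (u_le 0%N z) _; have [[_ /(_ z) + _] _] := hv 0%N.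
  by rewrite ler_norml => /andP[].
have bu : bounded_measurable u.
  split; last by exists 1.
  by apply: measurable_fun_infs => [z _|k]; [exact: lbv|have [[[]]] := hv k].
exists u; split=> //; split.
- by apply/measurable_EFinP; case: bu.
- by move=> z; rewrite lee_fin.
move=> V mV hV.
have bV := bounded_measurable_clip mV.
(* [m] is again admissible, so its mean is not below that of [u]; as [m <= u], they
   agree almost surely. *)
pose m z := Num.min (u z) (clip (V z)).
have bm : bounded_measurable m.
  split; first by apply: measurable_minr; [case: bu|case: bV].
  exists 1 => z; rewrite /m /Order.min; case: ifP => _ //; exact: clip_bound.
have Am : A m.
  split=> // [z|z]; first by rewrite /m /Order.min; case: ifP => _ //; exact: clip_bound.
  rewrite le_min hu/=; apply: le_clip => //.
  by apply: le_trans (ler_norm _) (h1 z).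
have mum : mean P (u \o J) <= mean P (m \o J).
  apply: (@le_trans _ _ (inf M)); last by apply: ge_inf; [exact: hM.2|exists m].
  apply/ler_addgt0Pr => e e0.
  have [k ke] : exists k : nat, k.+1%:R^-1 < e.
    have [k _ hk] := near_infty_natSinv_lt (PosNum e0).
    by exists k; apply: hk => /=.
  apply: (@le_trans _ _ (mean P (v k \o J))).
    apply: mean_le => //; [exact: bounded_measurable_comp| |by move=> w; exact: u_le].
    by apply: bounded_measurable_comp; have [[]] := hv k.
  by have [_ /ltW/le_trans] := hv k; apply; rewrite lerD2l ltW.
have bdiff := bounded_measurableB (bounded_measurable_comp bu) (bounded_measurable_comp bm).
have diff0 w : 0 <= u (J w) - m (J w) by rewrite subr_ge0 ge_min lexx.
have : (\int[P]_w `|((u (J w) - m (J w))%:E)| = 0)%E.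
  under eq_integral do rewrite gee0_abs ?lee_fin//.
  apply/eqP; rewrite eq_le; apply/andP; split; last first.
    by apply: integral_ge0 => w _; rewrite lee_fin.
  rewrite (meanE P1 bdiff) lee_fin meanB//; try exact: bounded_measurable_comp.
  by rewrite subr_le0.
move=> /(ae_eq_integral_abs P measurableT (f := fun w => (u (J w) - m (J w))%:E)).
move=> /(_ ltac:(by apply/measurable_EFinP; case: bdiff)).
apply: filterS => w /(_ I) /= [] /eqP; rewrite subr_eq0 => /eqP -> {bdiff diff0}.
apply: (@le_trans _ _ (clip (V (J w)))%:E); first by rewrite lee_fin ge_min lexx orbT.
apply: clip_le; apply: le_trans (hV (J w)); rewrite lee_fin.
by have := h1 (J w); rewrite ler_norml => /andP[].
Qed.

End majorants.

(** * Disintegration of the joint law of data and weights *)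

Section disintegration.
Context {R : realType} {dT dD dW : measure_display}.
Context {T : measurableType dT} {TD : measurableType dD} {TW : measurableType dW}.
Local Open Scope ereal_scope.

Section graph_kernel.
Variables (D : T -> TD) (K : R.-pker TD ~> TW).
Let mpair (y : TD) : measurable_fun setT (pair y : TW -> TD * TW).
Proof. by apply: measurable_fun_pair; [exact: measurable_cst|exact: measurable_id]. Qed.

(** The joint law is the composition of the law on the sample space with this
    kernel; the factor [unit] only gives the composition its parameter. The proof of
    measurability is an argument so that the kernel structure can be inferred. *)
Definition graph_law (mD : measurable_fun setT D) (x : unit * T) : {measure set (TD * TW) -> \bar R} :=
  measure_function_pushforward__canonical__measure_function_Measure
    (K (D x.2)) (mpair (D x.2)).

Hypothesis mD : measurable_fun setT D.

Lemma graph_lawE x A : graph_law mD x A = K (D x.2) (xsection A (D x.2)).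
Proof. by rewrite /graph_law /= /pushforward xsectionE. Qed.

Let measurable_graph_law A : measurable A ->
  measurable_fun setT (graph_law mD ^~ A).
Proof.
move=> mA; rewrite (_ : (fun _ => _) =
  (fun y => K y (xsection A y)) \o (D \o snd)); last first.
  by apply/funext => x; rewrite /= graph_lawE.
apply: measurableT_comp; last exact: measurableT_comp.
by apply: measurable_fun_xsection_finite_kernel; rewrite inE.
Qed.

HB.instance Definition _ := isKernel.Build _ _ _ _ R (graph_law mD) measurable_graph_law.

Let graph_law_prob x : graph_law mD x setT = 1.
Proof. by rewrite /graph_law/= /pushforward preimage_setT prob_kernel. Qed.

HB.instance Definition _ := Kernel_isProbability.Build _ _ _ _ R (graph_law mD) graph_law_prob.

End graph_kernel.

Variables (P : probability T R) (D : T -> TD) (W : T -> TW) (K : R.-pker TD ~> TW).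
Hypotheses (mD : measurable_fun setT D) (mW : measurable_fun setT W).
Hypothesis DWK : is_cond_law P D W K.


Let J w := (D w, W w).
Let mJ : measurable_fun setT J. Proof. exact: measurable_fun_pair. Qed.

Let base : R.-pker unit ~> T := kprobability (measurable_cst (P : pprobability T R)).
Let gr : R.-pker (unit * T) ~> (TD * TW)%type := graph_law K mD.
Let joint : {measure set (TD * TW)%type -> \bar R} := kcomp base gr tt.

Let jointE A : joint A = \int[P]_w K (D w) (xsection A (D w)).
Proof.
transitivity (\int[P]_w graph_law K mD (tt, w) A); first by [].
by apply: eq_integral => w _; exact: graph_lawE.
Qed.

Let joint_law A : measurable A -> joint A = P (J @^-1` A).
Proof.
move=> mA.
pose Q := measure_function_pushforward__canonical__measure_function_Measure P mJ.
pose C : set (set (TD * TW)%type) := [set A `*` B | A in measurable & B in measurable].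
suff : joint A = Q A by [].
apply: (measure_unique C (fun=> setT)) => //.
- by rewrite measurable_prod_measurableType.
- move=> _ _ [X1 mX1 [X2 mX2 <-]] [Y1 mY1 [Y2 mY2 <-]].
  by rewrite -setXI; exists (X1 `&` Y1); [exact: measurableI|
    exists (X2 `&` Y2) => //; exact: measurableI].
- by move=> n; exists setT => //; exists setT => //; rewrite setXTT.
- by rewrite bigcup_const.
- move=> _ [X mX [Y mY <-]]; rewrite jointE /=.
  rewrite [RHS](_ : _ = P (D @^-1` X `&` W @^-1` Y)) // (DWK mX mY).
  rewrite [RHS]integral_mkcond; apply: eq_integral => w _; rewrite patchE.
  case: ifPn => Dw; first by rewrite in_xsectionX//; move: Dw; rewrite !inE.
  by rewrite notin_xsectionX ?measure0//; move: Dw; rewrite !inE.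
- move=> n; rewrite jointE.
  under eq_integral do rewrite xsectionE preimage_setT prob_kernel.
  rewrite integral_cst// mul1e.
  by apply: le_lt_trans (probability_le1 P measurableT) (ltry _).
Qed.

(** Both sides integrate [f] against a probability on the product; the two
    probabilities agree on rectangles by the hypothesis on the kernel. *)
Lemma disintegration_ge0 (f : (TD * TW)%type -> \bar R) : measurable_fun setT f ->
  (forall z, 0 <= f z) ->
  \int[P]_w f (D w, W w) = \int[P]_w \int[K (D w)]_m f (D w, m).
Proof.
move=> mf f0.
have := @ge0_integral_pushforward _ _ _ _ _ _ mJ P setT f measurableT mf (fun z _ => f0 z).
rewrite preimage_setT /= => <-.
transitivity (\int[joint]_z f z).
  apply: eq_measure_integral => //= A mA _; exact/esym/joint_law.
rewrite /joint integral_kcomp//=; apply: eq_integral => w _.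
rewrite ge0_integral_pushforward// ?preimage_setT//.
Qed.

Lemma joint_null (N : set (TD * TW)%type) : measurable N -> P (J @^-1` N) = 0 ->
  {ae P, forall w, K (D w) (xsection N (D w)) = 0}.
Proof.
move=> mN PN.
have mf : measurable_fun setT (fun w => K (D w) (xsection N (D w))).
  have mN' : N \in measurable by rewrite inE.
  exact: (measurableT_comp (measurable_fun_xsection_finite_kernel K mN') mD).
have : \int[P]_w `|K (D w) (xsection N (D w))| = 0.
  by under eq_integral do rewrite gee0_abs//; rewrite -jointE joint_law.
by move=> /(ae_eq_integral_abs P measurableT mf); apply: filterS => w; exact.
Qed.

End disintegration.

(** * Gaps between majorants and minorants *)

Section conditional_mean.
Context {R : realType} {dT dD dW : measure_display}.
Context {T : measurableType dT} {TD : measurableType dD} {TW : measurableType dW}.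
Variables (P : probability T R) (D : T -> TD) (W : T -> TW) (K : R.-pker TD ~> TW).
Hypotheses (mD : measurable_fun setT D) (mW : measurable_fun setT W).
Hypothesis DWK : is_cond_law P D W K.

Let J w := (D w, W w).
Let mJ : measurable_fun setT J. Proof. exact: measurable_fun_pair. Qed.
Let P1 : P setT = 1%E. Proof. exact: probability_setT. Qed.
Let K1 y : K y setT = 1%E. Proof. exact: prob_kernel. Qed.

Definition cmean (u : (TD * TW)%type -> R) (w : T) : R :=
  mean (K (D w)) (fun m => u (D w, m)).

Lemma bounded_measurable_section (u : (TD * TW)%type -> R) y :
  bounded_measurable u -> bounded_measurable (fun m => u (y, m)).
Proof.
by move=> [mu [c hc]]; split; [exact: measurable_fun_pair2|exists c => m; exact: hc].
Qed.

Let cmean_nonneg (u : (TD * TW)%type -> R) : bounded_measurable u ->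
  (forall z, 0 <= u z) ->
  bounded_measurable (cmean u) /\ mean P (cmean u) = mean P (u \o J).
Proof.
move=> bu u0.
have mue : measurable_fun setT (EFin \o u) by apply/measurable_EFinP; case: bu.
have u0e z : (0 <= (EFin \o u) z)%E by rewrite lee_fin.
have bc : bounded_measurable (cmean u).
  split; last first.
    have [_ [c hc]] := bu; exists c => w; apply: mean_bound => //.
    exact: bounded_measurable_section.
  apply: (measurableT_comp (fine_measurable measurableT)).
  exact: (measurableT_comp (measurable_fun_integral_finite_kernel _ K u0e mue) mD).
split=> //; apply: EFin_inj; rewrite -!meanE//; last exact: bounded_measurable_comp.
have := disintegration_ge0 mD mW DWK mue u0e; rewrite /= => ->.
apply: eq_integral => w _; rewrite /cmean -meanE//.
exact: bounded_measurable_section.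
Qed.

Let shift_nonneg (u : (TD * TW)%type -> R) : bounded_measurable u ->
  exists c, bounded_measurable (fun z => u z + c) /\ forall z, 0 <= u z + c.
Proof.
move=> bu; have [_ [c hc]] := bu; exists c; split.
  by apply: bounded_measurableD => //; exact: bounded_measurable_cst.
by move=> z; have := hc z; rewrite ler_norml => /andP[]; lra.
Qed.

Let cmean_shift (u : (TD * TW)%type -> R) c w : bounded_measurable u ->
  cmean u w = cmean (fun z => u z + c) w - c.
Proof.
move=> bu; rewrite /cmean meanD//; last exact: bounded_measurable_cst.
  by rewrite mean_cst// addrK.
exact: bounded_measurable_section.
Qed.

Lemma bounded_measurable_cmean (u : (TD * TW)%type -> R) : bounded_measurable u ->
  bounded_measurable (cmean u).
Proof.
move=> bu; have [c [bc c0]] := shift_nonneg bu.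
rewrite (_ : cmean u = fun w => cmean (fun z => u z + c) w - c).
  apply: bounded_measurableB; last exact: bounded_measurable_cst.
  by have [] := cmean_nonneg bc c0.
by apply/funext => w; exact: cmean_shift.
Qed.

Lemma mean_cmean (u : (TD * TW)%type -> R) : bounded_measurable u ->
  mean P (cmean u) = mean P (u \o J).
Proof.
move=> bu; have [c [bc c0]] := shift_nonneg bu.
have [bcm e] := cmean_nonneg bc c0.
rewrite (_ : cmean u = fun w => cmean (fun z => u z + c) w - c); last first.
  by apply/funext => w; exact: cmean_shift.
rewrite meanB//; last exact: bounded_measurable_cst.
rewrite e mean_cst// -[RHS](addrK c); congr (_ - _).
have := meanD P1 (bounded_measurable_comp mJ bu) (bounded_measurable_cst c).
by rewrite mean_cst// => <-.
Qed.

Lemma cmeanB u v w : bounded_measurable u -> bounded_measurable v ->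
  cmean (fun z => u z - v z) w = cmean u w - cmean v w.
Proof. by move=> bu bv; apply: meanB => //; exact: bounded_measurable_section. Qed.

Lemma measurable_kernel_integral (U : (TD * TW)%type -> \bar R) :
  measurable_fun setT U ->
  measurable_fun setT (fun w => \int[K (D w)]_m U (D w, m))%E.
Proof.
move=> mU.
rewrite (_ : (fun _ => _) = (fun w => \int[K (D w)]_m (U^\+)%E (D w, m) -
    \int[K (D w)]_m (U^\-)%E (D w, m))%E); last first.
  by apply/funext => w; rewrite integralE; congr (_ - _)%E;
    apply: eq_integral => m _; rewrite ?funeposE ?funenegE.
apply: emeasurable_funB.
  apply: (measurableT_comp (measurable_fun_integral_finite_kernel _ K _ _) mD).
  - by move=> z; exact: funepos_ge0.
  - exact: measurable_funepos.
apply: (measurableT_comp (measurable_fun_integral_finite_kernel _ K _ _) mD).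
- by move=> z; exact: funeneg_ge0.
- exact: measurable_funeneg.
Qed.

Lemma kernel_integral_ae (U : (TD * TW)%type -> \bar R) u :
  measurable_fun setT U -> bounded_measurable u ->
  {ae P, forall w, U (J w) = (u (J w))%:E} ->
  {ae P, forall w, (\int[K (D w)]_m U (D w, m) = (cmean u w)%:E)%E}.
Proof.
move=> mU bu UuJ.
have mu : measurable_fun setT (EFin \o u) by apply/measurable_EFinP; case: bu.
pose N := [set z | U z != (u z)%:E].
have mN : measurable N.
  by have := measurable_neqe measurableT mU mu; rewrite setTI.
have PN : P (J @^-1` N) = 0%E.
  have mJN : measurable (J @^-1` N) by rewrite -[X in measurable X]setTI; exact: mJ.
  apply: (measure_negligible mJN); apply: negligibleS UuJ.
  by move=> w /= /eqP.
have := joint_null mD mW DWK mN PN; apply: filterS => w KN.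
rewrite /cmean -meanE//; last exact: bounded_measurable_section.
apply: ae_eq_integral => //; [exact: measurable_fun_pair2| |].
  exact: (measurable_fun_pair2 (D w) mu).
exists (xsection N (D w)); split=> //; first exact: measurable_xsection.
by move=> m /= /not_implyP[_ /eqP h]; apply/xsectionP.
Qed.

(** Convergence in probability of the conditional gap between a majorant and a
    minorant controls the mean gap, as the gap is bounded. *)
Lemma majorant_gap (h : TD * TW -> R) U L : (forall z, `|h z| <= 1) ->
  measurable_majorant P J h U -> measurable_minorant P J h L ->
  exists u l, [/\ bounded_measurable u, bounded_measurable l,
    (forall z, `|u z| <= 1) /\ (forall z, `|l z| <= 1),
    (forall z, l z <= h z <= u z) & forall e : R, 0 < e ->
      ((mean P (u \o J) - mean P (l \o J))%:E <= e%:E + 2%:E *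
      P [set w | e%:E < `| \int[K (D w)]_m U (D w, m)
                           - \int[K (D w)]_m L (D w, m) |])%E].
Proof.
move=> h1 majU minL.
have [hU aeU] := measurable_majorant_clip h1 majU.
have hn1 z : `|- h z| <= 1 by rewrite normrN.
have [hL aeL] := measurable_majorant_clip hn1 minL.
have [mU _ _] := majU; have [mNL _ _] := minL.
have mL : measurable_fun setT L.
  rewrite (_ : L = (fun z => - (- L z))%E); last by apply/funext => z; rewrite oppeK.
  exact: measurableT_comp.
pose u z := clip (U z); pose l z := - clip (- L z)%E.
have bu : bounded_measurable u by exact: bounded_measurable_clip.
have bl : bounded_measurable l.
  rewrite (_ : l = fun z => -1 * clip (- L z)%E); last first.
    by apply/funext => z; rewrite mulN1r.
  exact: (bounded_measurableZ (-1) (bounded_measurable_clip mNL)).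
have u1 z : `|u z| <= 1 by exact: clip_bound.
have l1 z : `|l z| <= 1 by rewrite normrN clip_bound.
have lhu z : l z <= h z <= u z by rewrite hU andbT lerNl hL.
exists u, l; split=> // e e0.
(* The conditional gap is at most [e] off [A] and at most 2 on [A]. *)
set A := [set w | _].
have iU := measurable_kernel_integral mU; have iL := measurable_kernel_integral mL.
have mA : measurable A.
  have m1 : measurable_fun setT (fun w => `| \int[K (D w)]_m U (D w, m)
                           - \int[K (D w)]_m L (D w, m) |)%E.
    by apply: measurableT_comp => //; exact: emeasurable_funB.
  have := measurable_lte measurableT (measurable_cst e%:E) m1.
  by rewrite setTI.
rewrite (mean_indic P1 mA) -EFinM -EFinD lee_fin.
rewrite -(mean_cmean bu) -(mean_cmean bl) -meanB//; try exact: bounded_measurable_cmean.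
have b1 : bounded_measurable (\1_A : T -> R) by exact: bounded_measurable_indic.
have b2 := bounded_measurableZ 2 b1.
rewrite -[X in X + _](mean_cst P1) -(meanZ P1 2 b1) -meanD//; last exact: bounded_measurable_cst.
apply: mean_ae_le => //.
- by apply: bounded_measurableB; exact: bounded_measurable_cmean.
- by apply: bounded_measurableD => //; exact: bounded_measurable_cst.
have aeL' : {ae P, forall w, L (J w) = (l (J w))%:E}.
  by apply: filterS aeL => w; rewrite /l EFinN => <-; rewrite oppeK.
have eU := kernel_integral_ae mU bu aeU; have eL := kernel_integral_ae mL bl aeL'.
apply: filterS2 eU eL => w eU eL.
rewrite indicE; have [wA|wA] := boolP (w \in A).
  have bnd (v : _ -> R) : bounded_measurable v -> (forall z, `|v z| <= 1) ->
      `|cmean v w| <= 1.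
    by move=> bv v1; apply: mean_bound => //; exact: bounded_measurable_section.
  have := bnd _ bu u1; have := bnd _ bl l1; rewrite !ler_norml mulr1.
  by move=> /andP[? ?] /andP[? ?]; lra.
rewrite mulr0 addr0; move: wA; rewrite notin_setE /A /= eU eL => /negP.
rewrite -leNgt -EFinB abse_EFin lee_fin; apply: le_trans; exact: ler_norm.
Qed.

(** Conversely, a small mean gap makes the conditional gap of the optimal pair
    small in probability, by Markov's inequality. *)
Lemma optimal_gap (h : TD * TW -> R) : (forall z, `|h z| <= 1) ->
  exists U L, [/\ measurable_majorant P J h U, measurable_minorant P J h L &
    forall u l (e : R), bounded_measurable u -> bounded_measurable l ->
      (forall z, l z <= h z <= u z) -> 0 < e ->
      (P [set w | e%:E < `| \int[K (D w)]_m U (D w, m)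
                           - \int[K (D w)]_m L (D w, m) |] <=
      ((mean P (u \o J) - mean P (l \o J)) / e)%:E)%E].
Proof.
move=> h1; have hn1 z : `|- h z| <= 1 by rewrite normrN.
have [u0 [bu0 u01 majU]] := measurable_majorant_exists P mJ h1.
have [l0 [bl0 l01 majL]] := measurable_majorant_exists P mJ hn1.
exists (EFin \o u0), (fun z => (- l0 z)%:E); split=> //.
  rewrite /measurable_minorant (_ : (fun z => - (- l0 z)%:E)%E = EFin \o l0)//.
  by apply/funext => z; rewrite /= opprK.
move=> u l e bu bl lhu e0.
have bnl : bounded_measurable (fun z => - l0 z).
  have := bounded_measurableZ (-1) bl0; congr bounded_measurable.
  by apply/funext => z; rewrite mulN1r.
have le_u : {ae P, forall w, u0 (J w) <= u (J w)}.
  have [_ _ /(_ (EFin \o u))] := majU.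
  move=> /(_ ltac:(by apply/measurable_EFinP; case: bu)).
  move=> /(_ (fun z => ltac:(by rewrite lee_fin; case/andP: (lhu z)))).
  by apply: filterS => w; rewrite lee_fin.
have le_l : {ae P, forall w, l (J w) <= - l0 (J w)}.
  have [_ _ /(_ (fun z => (- l z)%:E))] := majL.
  have bnl' := bounded_measurableZ (-1) bl.
  move=> /(_ ltac:(apply/measurable_EFinP; case: bnl' => + _;
     by congr measurable_fun; apply/funext => z; rewrite mulN1r)).
  move=> /(_ (fun z => ltac:(by rewrite lee_fin lerN2; case/andP: (lhu z)))).
  by apply: filterS => w; rewrite lee_fin /= lerNr.
have pointwise z : 0 <= u0 z - (- l0 z).
  have [_ /(_ z) + _] := majU; have [_ /(_ z) + _] := majL.
  by rewrite !lee_fin; lra.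
have bd := bounded_measurableB bu0 bnl.
have cm0 w : 0 <= cmean (fun z => u0 z - - l0 z) w.
  by apply: fine_ge0; apply: integral_ge0 => m _; rewrite lee_fin.
rewrite (_ : [set w | _] =
    [set w | (e < cmean (fun z => u0 z - - l0 z) w)%R]); last first.
  apply/seteqP; split => w /=; rewrite (meanE (K1 _) (bounded_measurable_section _ bu0))
    (meanE (K1 _) (bounded_measurable_section _ bnl)) -EFinB abse_EFin lte_fin
    -/(cmean u0 w) -/(cmean (fun z => - l0 z) w) -cmeanB// ger0_norm//.
have mset : measurable [set w | (e < cmean (fun z => u0 z - - l0 z) w)%R].
  rewrite -[X in measurable X]setTI (_ : mkset _ =
    (cmean (fun z => u0 z - - l0 z)) @^-1` `]e, +oo[).
    by apply: (bounded_measurable_cmean bd).1.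
  by apply/seteqP; split => w /=; rewrite in_itv/= andbT.
have bcm := bounded_measurable_cmean bd.
apply: (@le_trans _ _ (P [set w | e <= cmean (fun z => u0 z - - l0 z) w])).
  apply: le_measure; rewrite ?inE//.
    rewrite -[X in measurable X]setTI (_ : mkset _ =
      (cmean (fun z => u0 z - - l0 z)) @^-1` `[e, +oo[).
      by apply: bcm.1.
    by apply/seteqP; split => w /=; rewrite in_itv/= andbT.
  by move=> w /= /ltW.
apply: le_trans (mean_markov P1 bcm cm0 e0) _.
rewrite lee_fin ler_wpM2r ?invr_ge0 ?(ltW e0)//.
rewrite (mean_cmean bd) -meanB//; try exact: bounded_measurable_comp.
apply: mean_ae_le => //.
- exact: (bounded_measurable_comp mJ bd).
- by apply: bounded_measurableB; exact: bounded_measurable_comp.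
by apply: filterS2 le_u le_l => w h2 h3; apply: lerB.
Qed.

End conditional_mean.

(** * Consequences of conditional weak convergence *)

Section bounded_lipschitz.
Context {R : realType}.

Lemma cvge0P (u : nat -> \bar R) : (forall n, (0 <= u n)%E) ->
  (u n @[n --> \oo] --> 0%E) <->
  (forall e : R, 0 < e -> \forall n \near \oo, (u n <= e%:E)%E).
Proof.
move=> u0; split=> [/fine_cvgP[ufin /cvgrPdist_le uc] e e0|h].
  have := uc e e0; apply: filterS2 ufin => n un; rewrite /= sub0r normrN => h.
  by rewrite -(fineK un) lee_fin; exact: le_trans (ler_norm _) h.
apply/fine_cvgP; split.
  by apply: filterS (h 1 ltr01) => n un; rewrite ge0_fin_numE// (le_lt_trans un) ?ltry.
apply/cvgrPdist_le => e e0; apply: filterS (h e e0) => n un.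
rewrite /= sub0r normrN ger0_norm ?fine_ge0// -lee_fin fineK//.
by rewrite ge0_fin_numE// (le_lt_trans un) ?ltry.
Qed.

Lemma lipschitz_continuous (V V' : normedModType R) (f : V -> V') (c : R) :
    0 < c ->
  (forall z z', `|f z - f z'| <= c * `|z - z'|) -> continuous f.
Proof.
move=> c0 fl z; apply/cvgrPdist_le => e e0; near=> z'.
apply: le_trans (fl z z') _; rewrite -ler_pdivlMl//.
near: z'; have r0 : 0 < c^-1 * e by rewrite mulr_gt0 ?invr_gt0.
by apply: filterS (nbhsx_ballx z _ r0) => y; rewrite -ball_normE /= => /ltW.
Unshelve. all: by end_near. Qed.

Lemma BL1_continuous (V : normedModType R) (f : V -> R) : BL1 f -> continuous f.
Proof.
move=> [_ fl]; apply: (@lipschitz_continuous V R^o f 1) => // z z'.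
by rewrite mul1r; exact: fl.
Qed.

Lemma borel_map_comp d (T : measurableType d) (V V' : normedModType R)
    (Y : T -> V) (f : V -> V') :
  borel_map Y -> continuous f -> borel_map (fun w => f (Y w)).
Proof.
move=> mY /continuousP cf O oO; exact: mY (cf _ oO).
Qed.

Lemma borel_map_measurable d (T : measurableType d) (V : normedModType R)
    (Y : T -> V) (f : V -> R) :
  borel_map Y -> continuous f -> measurable_fun setT (fun w => f (Y w)).
Proof.
move=> mY /continuousP cf; apply: (measurability _ (RGenOInfty.measurableE R)).
move=> _ [_ [a ->] <-]; rewrite setTI.
have oO : open (f @^-1` `]a, +oo[%classic) by apply: cf; exact: interval_open.
exact: mY oO.
Qed.

Lemma BL1_bounded_measurable d (T : measurableType d) (V : normedModType R)
    (Y : T -> V) (f : V -> R) :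
  borel_map Y -> BL1 f -> bounded_measurable (fun w => f (Y w)).
Proof.
move=> mY fBL; split; last by exists 1 => w; exact: fBL.1.
exact: borel_map_measurable mY (BL1_continuous fBL).
Qed.

Lemma expectation_mean d (T : measurableType d) (P : probability T R) (u : T -> R) :
  bounded_measurable u -> ('E_P[u] = (mean P u)%:E)%E.
Proof. by move=> bu; rewrite unlock meanE//; exact: probability_setT. Qed.

End bounded_lipschitz.

Section conditional_convergence.
Context {R : realType} {d dD dW d' : measure_display}.
Context {T : measurableType d} {TD : nat -> measurableType dD}.
Context {TW : nat -> measurableType dW} {T' : measurableType d'}.
Variables (P : probability T R) (D : forall n, T -> TD n) (W : forall n, T -> TW n).
Variables (K : forall n, R.-pker (TD n) ~> (TW n)) (P' : probability T' R).
Hypotheses (mD : forall n, measurable_fun setT (D n)).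
Hypotheses (mW : forall n, measurable_fun setT (W n)).
Hypothesis DWK : forall n, is_cond_law P (D n) (W n) (K n).

Let J n w := (D n w, W n w).
Let mJ n : measurable_fun setT (J n). Proof. exact: measurable_fun_pair. Qed.
Let P1 : P setT = 1%E. Proof. exact: probability_setT. Qed.
Let P'1 : P' setT = 1%E. Proof. exact: probability_setT. Qed.
Let K1 n y : K n y setT = 1%E. Proof. exact: prob_kernel. Qed.

Section fixed_limit.
Context {V : normedModType R}.
Variables (Z : forall n, TD n -> TW n -> V) (Y : T' -> V).
Hypothesis mY : borel_map Y.

(** The bounded Lipschitz distance between the conditional law and the limit. *)
Definition bl_dist n w : \bar R := ereal_sup
  [set `| outer_integral (K n (D n w)) (fun m => f (Z (D n w) m))
          - 'E_P'[fun w' => f (Y w')] | | f in BL1]%E.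

Lemma bl_dist_term n w (f : V -> R) : BL1 f ->
  (`| outer_integral (K n (D n w)) (fun m => f (Z (D n w) m))
          - 'E_P'[fun w' => f (Y w')] | =
  `|outer_mean (K n (D n w)) (fun m => f (Z (D n w) m)) -
    mean P' (fun w' => f (Y w'))|%:E)%E.
Proof.
move=> fBL; rewrite (outer_meanE (K1 _) (c := 1)); last by move=> m; exact: fBL.1.
by rewrite expectation_mean ?EFinB//; exact: BL1_bounded_measurable.
Qed.

Lemma bl_dist_ge n w (e : R) (f : V -> R) : (bl_dist n w <= e%:E)%E -> BL1 f ->
  `|outer_mean (K n (D n w)) (fun m => f (Z (D n w) m)) -
    mean P' (fun w' => f (Y w'))| <= e.
Proof.
move=> de fBL; rewrite -lee_fin -bl_dist_term//; apply: le_trans de.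
by apply: ereal_sup_ubound; exists f.
Qed.

Lemma bl_dist_le n w (e : R) : (forall f : V -> R, BL1 f ->
  `|outer_mean (K n (D n w)) (fun m => f (Z (D n w) m)) -
    mean P' (fun w' => f (Y w'))| <= e) -> (bl_dist n w <= e%:E)%E.
Proof.
by move=> h; apply: ge_ereal_sup => _ [f fBL <-]; rewrite bl_dist_term// lee_fin; exact: h.
Qed.

Hypothesis cvgZ : cond_weak_cvg P D W K Z P' Y.

Lemma bl_dist_cvg (e x : R) : 0 < e -> 0 < x -> \forall n \near \oo,
  ((P^*)%mu [set w | (e%:E < bl_dist n w)%E] <= x%:E)%E.
Proof.
have [_ h _] := cvgZ => e0 x0.
by have /(cvge0P (fun n => mu_ext_ge0 _ _)) := h e e0; apply.
Qed.

Lemma asymptotic_gap (f : V -> R) (e : R) : BL1 f -> 0 < e ->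
  \forall n \near \oo, exists u l : TD n * TW n -> R,
  [/\ bounded_measurable u, bounded_measurable l,
      (forall z, `|u z| <= 1) /\ (forall z, `|l z| <= 1),
      (forall z, l z <= f (Z z.1 z.2) <= u z) &
      mean P (u \o J n) - mean P (l \o J n) <= e].
Proof.
move=> fBL e0; have [_ _ /(_ f fBL)[U [L [majU minL gap]]]] := cvgZ.
have e2 : 0 < e / 2 by rewrite divr_gt0.
have e4 : 0 < e / 4 by rewrite divr_gt0.
have /(cvge0P (fun n => measure_ge0 P _))/(_ _ e4) := gap _ e2.
apply: filterS => n hn.
have f1 (z : TD n * TW n) : `|f (Z z.1 z.2)| <= 1 by exact: fBL.1.
have [u [l [bu bl b1 lfu hgap]]] :=
  majorant_gap (@mD n) (@mW n) (@DWK n) f1 (majU n) (minL n).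
exists u, l; split=> //; rewrite -lee_fin.
apply: le_trans (hgap _ e2) _.
apply: le_trans (leeD2l _ (lee_wpmul2l _ hn)) _ => //.
by rewrite -EFinM -EFinD lee_fin; lra.
Qed.

(** Unconditional control of a test function from the conditional one: the minorant is
    below the conditional outer mean, which is close to the limit, and the mean gap
    between minorant and majorant vanishes. *)
Lemma asymptotic_upper (f : V -> R) (e : R) : BL1 f -> 0 < e ->
  \forall n \near \oo, exists u : TD n * TW n -> R,
  [/\ bounded_measurable u, forall z, f (Z z.1 z.2) <= u z &
      mean P (u \o J n) <= mean P' (fun w => f (Y w)) + e].
Proof.
move=> fBL e0.
have e3 : 0 < e / 3 by rewrite divr_gt0.
have e6 : 0 < e / 6 by rewrite divr_gt0.
have hgap := asymptotic_gap fBL e3; have hdist := bl_dist_cvg e3 e6.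
apply: filterS2 hgap hdist => n [u [l [bu bl [u1 l1] lfu gap]]] dist.
exists u; split=> // [z|]; first by case/andP: (lfu z).
have bcl := bounded_measurable_cmean (@mD n) (@mW n) (@DWK n) bl.
set c := mean P' _.
have c1 : -1 <= c.
  have := mean_bound P'1 (BL1_bounded_measurable mY fBL) (fun w => fBL.1 (Y w)).
  by rewrite ler_norml => /andP[].
pose A := [set w | c + e / 3 < cmean (D n) (K n) l w].
have mA : measurable A.
  rewrite -[X in measurable X]setTI (_ : A = cmean (D n) (K n) l @^-1` `]c + e / 3, +oo[).
    by apply: bcl.1.
  by apply/seteqP; split => w /=; rewrite in_itv/= andbT.
have PA : mean P \1_A <= e / 6.
  rewrite -lee_fin -mean_indic// -(measurable_mu_extE P mA).
  apply: le_trans dist; apply: le_mu_ext => w Aw /=.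
  rewrite ltNge; apply/negP => dw; move: Aw; rewrite /A /= ltNge => /negP; apply.
  have := bl_dist_ge dw fBL; rewrite -/c ler_norml => /andP[_].
  have f1 m : `|f (Z (D n w) m)| <= 1 by exact: fBL.1.
  have : cmean (D n) (K n) l w <= outer_mean (K n (D n w)) (fun m => f (Z (D n w) m)).
    apply: (mean_le_outer_mean (K1 _) f1) => [|m].
      exact: bounded_measurable_section.
    by case/andP: (lfu (D n w, m)).
  by lra.
have bA : bounded_measurable (\1_A : T -> R) by exact: bounded_measurable_indic.
have : mean P (l \o J n) <= c + e / 3 + 2 * mean P \1_A.
  rewrite -(mean_cmean (@mD n) (@mW n) (@DWK n) bl) -(meanZ P1 2 bA).
  rewrite -[X in X + _](mean_cst P1) -meanD//; last 2 first.
  - exact: bounded_measurable_cst.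
  - exact: bounded_measurableZ.
  apply: mean_le => // [|w].
    apply: bounded_measurableD; first exact: bounded_measurable_cst.
    exact: bounded_measurableZ.
  rewrite indicE; have [wA|] := boolP (w \in A).
    have : `|cmean (D n) (K n) l w| <= 1.
      by apply: mean_bound => //; exact: bounded_measurable_section.
    by rewrite ler_norml mulr1 => /andP[? ?]; lra.
  by rewrite notin_setE /A /= => /negP; rewrite -leNgt mulr0 addr0.
by lra.
Qed.

End fixed_limit.
End conditional_convergence.

(** * Stability under Lipschitz maps and negligible perturbations *)

Section perturbation.
Context {R : realType} {d dD dW d' : measure_display}.
Context {T : measurableType d} {TD : nat -> measurableType dD}.
Context {TW : nat -> measurableType dW} {T' : measurableType d'}.
Variables (P : probability T R) (D : forall n, T -> TD n) (W : forall n, T -> TW n).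
Variables (K : forall n, R.-pker (TD n) ~> (TW n)) (P' : probability T' R).
Hypotheses (mD : forall n, measurable_fun setT (D n)).
Hypotheses (mW : forall n, measurable_fun setT (W n)).
Hypothesis DWK : forall n, is_cond_law P (D n) (W n) (K n).

Let J n w := (D n w, W n w).
Let mJ n : measurable_fun setT (J n). Proof. exact: measurable_fun_pair. Qed.
Let P1 : P setT = 1%E. Proof. exact: probability_setT. Qed.
Let P'1 : P' setT = 1%E. Proof. exact: probability_setT. Qed.
Let K1 n y : K n y setT = 1%E. Proof. exact: prob_kernel. Qed.

Context {V V' : normedModType R}.
Variables (Z : forall n, TD n -> TW n -> V) (Z' : forall n, TD n -> TW n -> V').
Variables (Y : T' -> V) (Phi : V -> V') (c : R).
Hypothesis c1 : 1 <= c.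
Hypothesis Phi_lip : forall a b, `|Phi a - Phi b| <= c * `|a - b|.
Hypothesis close : forall e x : R, 0 < e -> 0 < x -> \forall n \near \oo,
  exists Bad : set (TD n * TW n), [/\ measurable Bad,
    (P (J n @^-1` Bad) <= x%:E)%E &
    forall z, ~ Bad z -> `|Z' z.1 z.2 - Phi (Z z.1 z.2)| <= e].
Hypothesis cvgZ : cond_weak_cvg P D W K Z P' Y.

Let c0 : 0 < c. Proof. by apply: lt_le_trans c1. Qed.

(* A test function of the image, rescaled to a test function of the source. *)
Let pull (f : V' -> R) a := c^-1 * f (Phi a).

Let pull_BL1 f : BL1 f -> BL1 (pull f).
Proof.
move=> [f1 fl]; split=> [z|z z'].
  rewrite normrM gtr0_norm ?invr_gt0// ler_pdivrMl// mulr1.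
  exact: le_trans (f1 _) c1.
rewrite -mulrBr normrM gtr0_norm ?invr_gt0// ler_pdivrMl//.
exact: le_trans (fl _ _) (Phi_lip _ _).
Qed.

Let pullK f a : f (Phi a) = c * pull f a.
Proof. by rewrite /pull mulVKf// gt_eqF. Qed.

Let mY : borel_map Y. Proof. by case: cvgZ. Qed.

(* Bounds the effect of the perturbation on a test function: [e] off the bad set, and
   the oscillation 2 of the test function on it. *)
Let slack n (Bad : set (TD n * TW n)) (e : R) z := e + 2 * \1_Bad z.

Let slack_bm n (Bad : set (TD n * TW n)) (e : R) : measurable Bad ->
  bounded_measurable (slack Bad e).
Proof.
move=> mB; apply: bounded_measurableD; first exact: bounded_measurable_cst.
by apply: bounded_measurableZ; exact: bounded_measurable_indic.
Qed.

Let slack_mean dS (S : measurableType dS) (mu : {measure set S -> \bar R})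
    (A : set S) (e : R) : mu setT = 1%E -> measurable A ->
  mean mu (fun z => e + 2 * \1_A z) = e + 2 * mean mu \1_A.
Proof.
move=> mu1 mA; have bA : bounded_measurable (\1_A : S -> R).
  exact: bounded_measurable_indic.
rewrite meanD//; [|exact: bounded_measurable_cst|exact: bounded_measurableZ].
by rewrite mean_cst// meanZ.
Qed.

Let slack_bound n (Bad : set (TD n * TW n)) (e : R) f z : BL1 f -> 0 < e ->
  (forall z, ~ Bad z -> `|Z' z.1 z.2 - Phi (Z z.1 z.2)| <= e) ->
  `|f (Z' z.1 z.2) - f (Phi (Z z.1 z.2))| <= slack Bad e z.
Proof.
move=> [f1 fl] e0 h; rewrite /slack indicE; have [zB|] := boolP (z \in Bad).
  rewrite mulr1; apply: le_trans (ler_normB _ _) _.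
  by have := f1 (Z' z.1 z.2); have := f1 (Phi (Z z.1 z.2)); lra.
rewrite notin_setE mulr0 addr0 => zB.
exact: le_trans (fl _ _) (h _ zB).
Qed.

Let dist_le n w (Bad : set (TD n * TW n)) (e e1 : R) : measurable Bad -> 0 < e ->
  (forall z, ~ Bad z -> `|Z' z.1 z.2 - Phi (Z z.1 z.2)| <= e) ->
  (bl_dist D K P' Z Y n w <= e1%:E)%E ->
  (bl_dist D K P' Z' (Phi \o Y) n w <=
    (c * e1 + e + 2 * cmean (D n) (K n) \1_Bad w)%:E)%E.
Proof.
move=> mB e0 hB de; apply: bl_dist_le => [|f fBL].
  exact: borel_map_comp (lipschitz_continuous c0 Phi_lip).
have gBL := pull_BL1 fBL.
have := bl_dist_ge mY de gBL.
set og := outer_mean _ _; set mg := mean _ _ => dg.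
have -> : mean P' (fun w' => f ((Phi \o Y) w')) = c * mg.
  rewrite /mg -meanZ//; last exact: BL1_bounded_measurable.
  by congr mean; apply/funext => w'; exact: pullK.
set kw := K n (D n w).
have kw1 : kw setT = 1%E by exact: K1.
have f1' m : `|f (Z' (D n w) m)| <= 1 by exact: fBL.1.
have f1 m : `|f (Phi (Z (D n w) m))| <= 1 by exact: fBL.1.
have og_eq : outer_mean kw (fun m => f (Phi (Z (D n w) m))) = c * og.
  rewrite /og -(outer_meanZ kw1 (c := 1))//; last by move=> m; exact: gBL.1.
  by congr outer_mean; apply/funext => m; exact: pullK.
have bs := bounded_measurable_section (D n w) (slack_bm e mB).
have ms : mean kw (fun m => slack Bad e (D n w, m)) =
    e + 2 * cmean (D n) (K n) \1_Bad w.
  rewrite /cmean -/kw; have := @slack_mean _ _ kw (xsection Bad (D n w)) e kw1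
    (measurable_xsection _ mB).
  rewrite /slack; have -> // : (\1_(xsection Bad (D n w)) : TW n -> R) =
    (fun m => \1_Bad (D n w, m)).
  by apply/funext => m; rewrite !indicE mem_xsection.
have sb m := @slack_bound n Bad e f (D n w, m) fBL e0 hB.
have up : outer_mean kw (fun m => f (Z' (D n w) m)) <= c * og +
    (e + 2 * cmean (D n) (K n) \1_Bad w).
  rewrite -og_eq -ms; apply: (outer_mean_perturb kw1 f1' f1 bs) => m.
  by have := sb m; rewrite ler_norml /= => /andP[? ?]; lra.
have lo : c * og <= outer_mean kw (fun m => f (Z' (D n w) m)) +
    (e + 2 * cmean (D n) (K n) \1_Bad w).
  rewrite -og_eq -ms; apply: (outer_mean_perturb kw1 f1 f1' bs) => m.
  by have := sb m; rewrite ler_norml /= => /andP[? ?]; lra.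
have : `|c * og - c * mg| <= c * e1.
  by rewrite -mulrBr normrM gtr0_norm// ler_wpM2l// ltW.
by rewrite !ler_norml => /andP[? ?]; apply/andP; split; lra.
Qed.

(** Part (i): the conditional bounded Lipschitz distance grows by the conditional mean
    of the slack, which is small in probability by Markov's inequality. Part (ii):
    the slack is added to an upper bound for the source and subtracted from a lower
    bound, and the resulting mean gap bounds that of the optimal pair. *)
Theorem cond_weak_cvg_perturb : cond_weak_cvg P D W K Z' P' (fun w => Phi (Y w)).
Proof.
have mPY : borel_map (fun w => Phi (Y w)).
  exact: borel_map_comp (lipschitz_continuous c0 Phi_lip).
split=> [//|e e0|f fBL].
  apply/(cvge0P (fun n => mu_ext_ge0 _ _)) => // x x0.
  have c20 : 0 < c * 2 by rewrite mulr_gt0.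
  have e1 : 0 < e / (c * 2) by rewrite divr_gt0.
  have e4 : 0 < e / 4 by rewrite divr_gt0.
  have k0 : 0 < e / 8 by rewrite divr_gt0.
  have x2 : 0 < x / 2 by rewrite divr_gt0.
  have hd := bl_dist_cvg cvgZ e1 x2.
  have hB := close e4 (mulr_gt0 x2 k0).
  apply: filterS2 hd hB => n hd [Bad [mB PB hB]].
  have bB : bounded_measurable (\1_Bad : TD n * TW n -> R).
    exact: bounded_measurable_indic.
  have bc := bounded_measurable_cmean (@mD n) (@mW n) (@DWK n) bB.
  have cm0 w : 0 <= cmean (D n) (K n) \1_Bad w.
    by apply: fine_ge0; apply: integral_ge0 => m _; rewrite lee_fin.
  pose A := [set w | e / 8 <= cmean (D n) (K n) \1_Bad w].
  have mA : measurable A.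
    rewrite -[X in measurable X]setTI (_ : A = cmean (D n) (K n) \1_Bad @^-1` `[e / 8, +oo[).
      by apply: bc.1.
    by apply/seteqP; split => w /=; rewrite in_itv/= andbT.
  have PA : (P A <= (x / 2)%:E)%E.
    apply: le_trans (mean_markov P1 bc cm0 k0) _; rewrite lee_fin ler_pdivrMr//.
    rewrite (mean_cmean (@mD n) (@mW n) (@DWK n) bB) -lee_fin; apply: le_trans PB.
    rewrite (_ : \1_Bad \o J n = \1_(J n @^-1` Bad)); last first.
      by apply/funext => w; rewrite /= !indicE.
    rewrite -mean_indic// -[X in measurable X]setTI; exact: mJ.
  rewrite [x]splitr EFinD.
  apply: (@le_trans _ _ (P^* [set w | ((e / (c * 2))%:E < bl_dist D K P' Z Y n w)%E] +
    P^* A)%E)%mu; last by apply: leeD => //; rewrite (measurable_mu_extE P mA).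
  apply: le_trans (outer_measureU2 _ _ _).
  apply: le_mu_ext => w /=; rewrite ltNge => /negP edist.
  have [|dw] := boolP (bl_dist D K P' Z Y n w <= (e / (c * 2))%:E)%E; last first.
    by left; rewrite /= ltNge.
  move=> dw; right; rewrite /A /= leNgt; apply/negP => cw; apply: edist.
  apply: le_trans (dist_le mB e4 hB dw) _; rewrite lee_fin.
  have -> : c * (e / (c * 2)) = e / 2 by field; rewrite gt_eqF.
  by lra.
have f1 n (z : TD n * TW n) : `|f (Z' z.1 z.2)| <= 1 by exact: fBL.1.
have hUL n := optimal_gap (@mD n) (@mW n) (@DWK n) (f1 n).
pose U n := sval (cid (hUL n)); pose L n := sval (cid (svalP (cid (hUL n)))).
have UL n : [/\ measurable_majorant P (J n) (fun z => f (Z' z.1 z.2)) (U n),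
    measurable_minorant P (J n) (fun z => f (Z' z.1 z.2)) (L n) &
    forall u l (e : R), bounded_measurable u -> bounded_measurable l ->
      (forall z, l z <= f (Z' z.1 z.2) <= u z) -> 0 < e ->
      (P [set w | e%:E < `| \int[K n (D n w)]_m U n (D n w, m)
                           - \int[K n (D n w)]_m L n (D n w, m) |] <=
      ((mean P (u \o J n) - mean P (l \o J n)) / e)%:E)%E].
  exact: (svalP (cid (svalP (cid (hUL n))))).
exists U, L; split=> [n|n|e e0]; [by have [] := UL n|by have [] := UL n|].
apply/(cvge0P (fun n => measure_ge0 P _)) => // x x0.
have ex0 : 0 < e * x by rewrite mulr_gt0.
have c40 : 0 < c * 4 by rewrite mulr_gt0.
have y1 : 0 < e * x / (c * 4) by rewrite divr_gt0.
have y2 : 0 < e * x / 8 by rewrite divr_gt0.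
have y3 : 0 < e * x / 16 by rewrite divr_gt0.
have hg := asymptotic_gap mD mW DWK cvgZ (pull_BL1 fBL) y1.
have hB := close y2 y3.
apply: filterS2 hg hB => n [u [l [bu bl _ lgu gap]]] [Bad [mB PB hB]].
have [_ _ opt] := UL n.
have bs := slack_bm (e * x / 8) mB.
have bcu := bounded_measurableZ c bu; have bcl := bounded_measurableZ c bl.
have bu' := bounded_measurableD bcu bs; have bl' := bounded_measurableB bcl bs.
apply: le_trans (opt _ _ e bu' bl' _ e0) _.
  move=> z; have := @slack_bound n Bad _ f z fBL y2 hB.
  rewrite ler_norml !pullK => /andP[s1 s2].
  have /andP[l1 u1] := lgu z.
  have : c * l z <= c * pull f (Z z.1 z.2) by rewrite ler_wpM2l// ltW.
  have : c * pull f (Z z.1 z.2) <= c * u z by rewrite ler_wpM2l// ltW.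
  by move=> ? ?; apply/andP; split; lra.
rewrite lee_fin ler_pdivrMr//.
have bJ (v : TD n * TW n -> R) : bounded_measurable v -> bounded_measurable (v \o J n).
  by move=> bv; exact: (bounded_measurable_comp (@mJ n) bv).
have mJB : measurable (J n @^-1` Bad).
  by rewrite -[X in measurable X]setTI; exact: mJ.
have ms : mean P (slack Bad (e * x / 8) \o J n) <= e * x / 8 + 2 * (e * x / 16).
  have := @slack_mean _ _ P (J n @^-1` Bad) (e * x / 8) P1 mJB.
  rewrite (_ : (fun z => _) = slack Bad (e * x / 8) \o J n); last first.
    by apply/funext => w; rewrite /slack /= !indicE.
  move=> ->; rewrite lerD2l ler_wpM2l//.
  by rewrite -lee_fin -mean_indic.
have -> : mean P ((fun z => c * u z + slack Bad (e * x / 8) z) \o J n) =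
    c * mean P (u \o J n) + mean P (slack Bad (e * x / 8) \o J n).
  by rewrite -(meanZ P1 c (bJ _ bu)) -meanD//; [exact: bJ bcu|exact: bJ].
have -> : mean P ((fun z => c * l z - slack Bad (e * x / 8) z) \o J n) =
    c * mean P (l \o J n) - mean P (slack Bad (e * x / 8) \o J n).
  by rewrite -(meanZ P1 c (bJ _ bl)) -meanB//; [exact: bJ bcl|exact: bJ].
have : c * (mean P (u \o J n) - mean P (l \o J n)) <= c * (e * x / (c * 4)).
  by rewrite ler_wpM2l// ltW.
have -> : c * (e * x / (c * 4)) = e * x / 4 by field; rewrite gt_eqF.
by lra.
Qed.

End perturbation.

(** * The limit field *)

Section gaussian_part.
Context {R : realType} {d : nat} {dT : measure_display} {T : measurableType dT}.
Variables (P : probability T R) (C : 'rV[R]_d -> R).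
Hypothesis copC : is_copula C.
Hypothesis C_derivable : forall p u, Defs.cube R d u -> 0 < u ord0 p < 1 ->
  has_pderive C p u.

(** A linear combination of values of the image is one of values of the original
    field, with one term for each point and d terms for its margins. *)
Lemma gaussian_copula_derivative (B : T -> linfty R (cube R d)) :
  gaussian_field P B -> gaussian_field P (fun w => copula_derivative C (B w)).
Proof.
move=> gB k a u.
pose I := ('I_k * option 'I_d)%type.
pose a' (i : I) : R := if i.2 is Some p then - (a i.1 * pderive C p (val (u i.1))) else a i.1.
pose u' (i : I) : cube R d := if i.2 is Some p then cube_margin (u i.1) p else u i.1.
have := gB #|{: I}| (a' \o enum_val) (u' \o enum_val).
congr gaussian_rv; apply/funext => w /=.
rewrite -(big_enum_val (fun i : I => a' i * B w (u' i))) /=.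
rewrite -(pair_big xpredT xpredT (fun i o => a' (i, o) * B w (u' (i, o)))) /=.
apply: eq_bigr => i _; rewrite (copula_derivativeE copC C_derivable).
rewrite (bigD1 None)//= {1}/a' {1}/u' /= mulrBr; congr (_ + _).
rewrite (reindex_omap Some id) /=; last by case.
rewrite mulr_sumr -sumrN; apply: eq_big => [p|p _]; first by rewrite eqxx.
by rewrite /a' /u' /= mulNr mulrA.
Qed.

End gaussian_part.

Section limit_gauge.
Context {R : realType} {d : nat} {dT : measure_display} {T : measurableType dT}.
Variables (P : probability T R) (B : T -> linfty R (cube R d)).
Hypothesis mB : borel_map B.
Hypothesis B_D0 : P (B @^-1` D0) = 1%E.

Lemma mean_gauge_test_cvg : mean P (fun w => gauge_test k (B w)) @[k --> \oo] --> 0.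
Proof.
have bf k : bounded_measurable (fun w => gauge_test k (B w)).
  exact: BL1_bounded_measurable mB (gauge_test_BL1 k).
have mf k : measurable_fun setT (fun w => (gauge_test k (B w))%:E).
  by apply/measurable_EFinP; case: (bf k).
have mDc : measurable (B @^-1` ~` D0) by apply: mB; exact/closed_openC/D0_closed.
have mD0 : measurable (B @^-1` D0).
  by rewrite -[D0]setCK -preimage_setC; exact: measurableC.
have PDc : P (B @^-1` ~` D0) = 0%E.
  by rewrite -preimage_setC probability_setC// B_D0 subee.
have [_ _] := @dominated_convergence _ _ _ P setT measurableT
  (fun k w => (gauge_test k (B w))%:E) (fun=> 0%E) (fun=> 1%E)
  mf (measurable_cst _)
  ltac:(exists (B @^-1` ~` D0); split=> // w /= h Dw; apply: h => _;
        apply: cvg_EFin; [exact: nearW|exact: gauge_test_D0])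
  (bounded_measurable_integrable (probability_setT P) (bounded_measurable_cst 1))
  ltac:(apply: aeW => w k _; rewrite lee_fin ger0_norm ?gauge_test_ge0// ge_min lexx//).
rewrite integral0 => /fine_cvgP[_]; apply: cvg_trans.
by apply: near_eq_cvg; exact: nearW.
Qed.

End limit_gauge.

(** * A measurable description of small gauges *)

Section measurable_cover.
Context {R : realType} {d : nat}.
Notation cube := (cube R d).
Notation linf := (linfty R cube).
Variables (F : 'I_d -> R -> R) (C : 'rV[R]_d -> R).
Hypothesis copC : is_copula C.

(** The empirical distribution function does not change before the next sample point
    in some coordinate is reached, and [C] is continuous. *)
Lemma alpha_right_continuous n (x : n.-tuple (d.-tuple R)) (u : cube) (e : R) :
  0 < e -> exists2 r : R, 0 < r & forall v : cube,
    (forall p, val u ord0 p <= val v ord0 p < val u ord0 p + r) ->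
    `|alpha F C x v - alpha F C x u| <= e.
Proof.
move=> e0; pose y := unif_sample F x.
have /choice[s hs] (p : 'I_d) : exists s, val u ord0 p < s /\
    forall i, val u ord0 p < tnth (tnth y i) p -> s <= tnth (tnth y i) p.
  by have [s] := gap_above (fun i => tnth (tnth y i) p) (val u ord0 p); exists s.
pose c : R := Num.sqrt n%:R * d%:R.
have c0 : 0 <= c by rewrite mulr_ge0 ?sqrtr_ge0.
pose r0 : R := e / (c + 1).
have c1 : 0 < c + 1 by rewrite ltr_wpDl.
have r00 : 0 < r0 by rewrite divr_gt0.
exists (\big[Num.min/r0]_p (s p - val u ord0 p)).
  by apply: lt_bigmin => // p _; rewrite subr_gt0; case: (hs p).
move=> v uv; have uvr p : val u ord0 p <= val v ord0 p /\
    val v ord0 p < s p /\ val v ord0 p - val u ord0 p <= r0.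
  have /andP[h1 h2] := uv p; split=> //; split.
    apply: lt_le_trans h2 _; rewrite -lerBrDl.
    by apply: (@bigmin_le _ _ _ _ p (fun p => s p - val u ord0 p)).
  rewrite lerBlDl; apply: ltW; apply: lt_le_trans h2 _; rewrite lerD2l.
  exact: bigmin_le_id.
have eE : edf y (val v) = edf y (val u).
  congr (_ * _); apply: eq_bigr => i _; congr (_%:R); congr nat_of_bool.
  apply/forallP/forallP => h p; last first.
    by apply: le_trans (h p) _; case: (uvr p).
  rewrite leNgt; apply/negP => /(hs p).2; rewrite leNgt => /negP; apply.
  by apply: le_lt_trans (h p) _; have [_ []] := uvr p.
rewrite !alphaE// -/y eE -mulrBr.
have -> : edf y (val u) - C (val v) - (edf y (val u) - C (val u)) =
  - (C (val v) - C (val u)) by ring.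
rewrite normrM normrN (ger0_norm (sqrtr_ge0 _)).
have h : `|C (val v) - C (val u)| <= d%:R * r0.
  apply: le_trans (copula_lip copC (cubeP u) (cubeP v)) _.
  rewrite mulr_natl -[X in _ *+ X]card_ord -sumr_const; apply: ler_sum => p _.
  by have [h1 [_ h2]] := uvr p; rewrite ger0_norm// subr_ge0.
apply: (@le_trans _ _ (c * r0)); first by rewrite -mulrA ler_wpM2l ?sqrtr_ge0.
rewrite /r0 mulrCA ger_pMr// ler_pdivrMr// mul1r lerDl ler01//.
Qed.

(** The truncation puts the points of all rational vectors into the cube, so that the
    index set is countable without further argument. *)
Definition rat_point (q : {ffun 'I_d -> rat}) : 'rV[R]_d :=
  \row_p Num.max 0 (Num.min 1 (ratr (q p))).

Lemma cube_rat_point q : Defs.cube R d (rat_point q).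
Proof. by move=> p; rewrite mxE le_max lexx ge_max ler01 ge_min lexx. Qed.

(** Coordinates equal to 0 or 1 are kept, for otherwise an edge point would be
    approached by points where nothing forces [alpha] to be small. *)
Lemma rat_point_approx (u : cube) (r : R) : 0 < r -> exists q,
  (forall p, val u ord0 p <= rat_point q ord0 p < val u ord0 p + r) /\
  (edge u -> edge (in_cube (cube_rat_point q))).
Proof.
move=> r0.
have /choice[q hq] (p : 'I_d) : exists q : rat,
    [/\ 0 <= (ratr q : R) <= 1, val u ord0 p <= ratr q < val u ord0 p + r,
      val u ord0 p = 1 -> ratr q = 1 :> R & val u ord0 p = 0 -> ratr q = 0 :> R].
  have /andP[u0 u1] := cubeP u p; set t := val u ord0 p in u0 u1 *.
  have [t1|t1] := eqVneq t 1.
    by exists 1; rewrite rmorph1 t1 ler01 !lexx ltrDl; split=> // /eqP; rewrite oner_eq0.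
  have [t0|t0] := eqVneq t 0.
    by exists 0; rewrite rmorph0 t0 ler01 !lexx add0r; split=> // /esym/eqP; rewrite oner_eq0.
  have tlt : t < Num.min (t + r) 1 by rewrite lt_min ltrDl r0 lt_neqAle t1.
  have [q] := rat_in_itvoo tlt.
  rewrite in_itv/= lt_min => /andP[tq /andP[qr q1]].
  exists q; rewrite (le_trans u0 (ltW tq)) (ltW q1) (ltW tq) qr; split=> //.
  - by move=> /eqP; rewrite (negbTE t1).
  - by move=> /eqP; rewrite (negbTE t0).
have qE p : rat_point [ffun p => q p] ord0 p = ratr (q p).
  rewrite mxE ffunE; have [/andP[q0 q1] _ _ _] := hq p.
  by rewrite (min_idPr q1) (max_idPr q0).
exists [ffun p => q p]; split=> [p|]; first by rewrite qE; case: (hq p).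
case=> [u1|[p u0]]; [left => p|right; exists p]; rewrite /= qE.
- by have [_ _ /(_ (u1 p))] := hq p.
- by have [_ _ _ /(_ u0)] := hq p.
Qed.

Definition rpt q : cube := in_cube (cube_rat_point q).

(** The gauge as a supremum over all probes need not be a measurable function of the
    sample by its definition; restricting the probes to countably many points
    describes the same event for right continuous paths and keeps it measurable. *)
Definition rough_set n k (g : R) : set (n.-tuple (d.-tuple R)) :=
  \bigcup_(q : {ffun 'I_d -> rat} * {ffun 'I_d -> rat})
   [set x |
    [\/ (forall p, `|val (rpt q.1) ord0 p - val (rpt q.2) ord0 p| < k.+1%:R^-1) /\
        g < `|alpha F C x (rpt q.1) - alpha F C x (rpt q.2)|,
      edge (rpt q.1) /\ g < `|alpha F C x (rpt q.1)| |
      g < `|k.+1%:R^-1 * alpha F C x (rpt q.1)|]].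

Lemma gauge_gt_rough n k g (x : n.-tuple (d.-tuple R)) :
  rough_set k g x -> g < gauge k (alpha F C x).
Proof.
move=> [q _ [[h /lt_le_trans]|[h /lt_le_trans]|/lt_le_trans]]; apply.
- exact: gauge_close.
- exact: gauge_edge.
- by rewrite normrM ger0_norm ?invr_ge0// ler_pdivrMl ?ltr0Sn//; exact: gauge_norm.
Qed.

Let close_shift (a b a' b' s K : R) : s <= K - `|a - b| ->
  a <= a' < a + s -> b <= b' < b + s -> `|a' - b'| < K.
Proof.
move=> h /andP[? ?] /andP[? ?]; have := ler_norm (a - b).
have := ler_norm (- (a - b)); rewrite normrN => ? ?.
by rewrite ltr_norml; apply/andP; split; lra.
Qed.

Lemma gauge_le_smooth n k g (x : n.-tuple (d.-tuple R)) : 0 <= g ->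
  ~ rough_set k g x -> gauge k (alpha F C x) <= g.
Proof.
move=> g0 nrough; set z := alpha F C x.
have appr (u : cube) (e s : R) : 0 < e -> 0 < s -> exists q,
    [/\ forall p, val u ord0 p <= val (rpt q) ord0 p < val u ord0 p + s,
      edge u -> edge (rpt q) & `|z (rpt q) - z u| <= e].
  move=> e0 s0; have [r r0 hr] := alpha_right_continuous x u e0.
  have m0 : 0 < Num.min r s by rewrite lt_min r0.
  have [q [hq eq]] := rat_point_approx u m0; exists q; split=> // [p|].
    have /andP[-> h] := hq p; apply: lt_le_trans h _.
    by rewrite lerD2l ge_min lexx orbT.
  apply: hr => p; have /andP[h1 h] := hq p; rewrite /= h1; apply: lt_le_trans h _.
  by rewrite lerD2l ge_min lexx.
apply: gauge_le => // l lk; apply/ler_addgt0Pr => e e0.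
case: lk => [[u [v [uv ->]]]|[u [eu ->]]|[u ->]].
- have e2 : 0 < e / 2 by rewrite divr_gt0.
  pose s : R := \big[Num.min/1]_p (k.+1%:R^-1 - `|val u ord0 p - val v ord0 p|).
  have s0 : 0 < s by apply: lt_bigmin => // p _; rewrite subr_gt0.
  have [q1 [h1 _ z1]] := appr u _ _ e2 s0; have [q2 [h2 _ z2]] := appr v _ _ e2 s0.
  have zz : `|z (rpt q1) - z (rpt q2)| <= g.
    rewrite leNgt; apply/negP => gz; apply: nrough; exists (q1, q2) => //.
    apply: Or31; split=> // p.
    have sp : s <= k.+1%:R^-1 - `|val u ord0 p - val v ord0 p|.
      exact: (@bigmin_le _ _ _ _ p (fun p => k.+1%:R^-1 - `|val u ord0 p - val v ord0 p|)).
    exact: close_shift sp (h1 p) (h2 p).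
  move: zz z1 z2; rewrite !ler_norml => /andP[? ?] /andP[? ?] /andP[? ?].
  by apply/andP; split; lra.
- have [q [_ he z1]] := appr u _ _ e0 ltr01.
  have zz : `|z (rpt q)| <= g.
    rewrite leNgt; apply/negP => gz; apply: nrough; exists (q, q) => //.
    by apply: Or32; split=> //; exact: he.
  move: zz z1; rewrite !ler_norml => /andP[? ?] /andP[? ?].
  by apply/andP; split; lra.
- have [q [_ _ z1]] := appr u _ _ e0 ltr01.
  have zz : `|k.+1%:R^-1 * z (rpt q)| <= g.
    rewrite leNgt; apply/negP => gz; apply: nrough; exists (q, q) => //.
    exact: Or33.
  have : `|k.+1%:R^-1 * (z (rpt q) - z u)| <= e.
    rewrite normrM ger0_norm ?invr_ge0// ler_pdivrMl ?ltr0Sn//.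
    by apply: le_trans z1 _; rewrite ler_peMl// ?ler1n// ltW.
  rewrite /= mulrBr; move: zz; set a := k.+1%:R^-1 * z (rpt q); set b := k.+1%:R^-1 * z u; rewrite !ler_norml => /andP[? ?] /andP[? ?].
  by apply/andP; split; lra.
Qed.

Hypothesis mF : forall p, measurable_fun setT (F p).

Lemma measurable_alpha n (u : cube) :
  measurable_fun setT (fun x : n.-tuple (d.-tuple R) => alpha F C x u).
Proof.
under eq_fun do rewrite alphaE//.
apply: measurable_funM; first exact: measurable_cst.
apply: measurable_funB; last exact: measurable_cst.
apply: measurable_funM; first exact: measurable_cst.
apply: measurable_sum => i.
rewrite (_ : (fun _ => _) = \1_(\bigcap_(p in [set: 'I_d])
   ((fun x : n.-tuple (d.-tuple R) => F p (tnth (tnth x i) p)) @^-1` `]-oo, val u ord0 p]))).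
  apply: measurable_indic; apply: fin_bigcap_measurable => [|p _].
    exact: finite_finset.
  rewrite -[X in measurable X]setTI.
  have mt : measurable_fun setT (fun x : n.-tuple (d.-tuple R) => F p (tnth (tnth x i) p)).
    apply: (measurableT_comp (@mF p)).
    exact: (measurableT_comp (measurable_tnth p) (measurable_tnth i)).
  exact: mt.
apply/funext => x; rewrite indicE; congr (_%:R); congr nat_of_bool.
apply/forallP/idP => [h|].
  rewrite inE => p _; rewrite /= in_itv/=.
  by have := h p; rewrite !tnth_mktuple.
rewrite inE => h p; have := h p I; rewrite /= in_itv/=.
by rewrite !tnth_mktuple.
Qed.

Lemma measurable_rough_set n k g : measurable (@rough_set n k g).
Proof.
have mgt (f : n.-tuple (d.-tuple R) -> R) : measurable_fun setT f ->
    measurable [set x | g < `|f x|].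
  move=> mf; have mnf : measurable_fun setT (fun x => `|f x|) by exact: measurableT_comp.
  rewrite -[X in measurable X]setTI (_ : mkset _ = (fun x => `|f x|) @^-1` `]g, +oo[).
    exact: mnf.
  by apply/seteqP; split => x /=; rewrite in_itv/= andbT.
have mand (Q : Prop) (A : set (n.-tuple (d.-tuple R))) : measurable A ->
    measurable [set x | Q /\ A x].
  move=> mA; have [q|q] := pselect Q.
    by rewrite (_ : mkset _ = A)//; apply/seteqP; split => [x []|x].
  by rewrite (_ : mkset _ = set0)//; apply/seteqP; split => [x []|x].
apply: countable_bigcupT_measurable => [|q]; first exact: countableP.
rewrite (_ : mkset _ = [set x | (forall p, `|val (rpt q.1) ord0 p - val (rpt q.2) ord0 p| < k.+1%:R^-1) /\
        [set x : n.-tuple (d.-tuple R) | g < `|alpha F C x (rpt q.1) - alpha F C x (rpt q.2)|] x] `|`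
   [set x | edge (rpt q.1) /\ [set x : n.-tuple (d.-tuple R) | g < `|alpha F C x (rpt q.1)|] x] `|`
   [set x | g < `|k.+1%:R^-1 * alpha F C x (rpt q.1)|]); last first.
  apply/seteqP; split => x /=.
    by move=> [h|h|h]; [left; left|left; right|right].
  by move=> [[h|h]|h]; [apply: Or31|apply: Or32|apply: Or33].
apply: measurableU; first apply: measurableU.
- by apply: mand; apply: mgt; apply: measurable_funB; exact: measurable_alpha.
- by apply: mand; apply: mgt; exact: measurable_alpha.
- apply: mgt; apply: measurable_funM; first exact: measurable_cst.
  exact: measurable_alpha.
Qed.

End measurable_cover.

(** * The bootstrap of the empirical copula process *)

Section sampling.
Context {R : realType} {d : nat} {dT : measure_display} {T : measurableType dT}.
Variable P : probability T R.

Lemma marginal_df_homo (Z : {RV P >-> d.-tuple R}) p :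
  {homo marginal_df P Z p : s t / s <= t}.
Proof.
have mZ t : measurable [set w | tnth (Z w) p <= t].
  rewrite -[X in measurable X]setTI.
  rewrite (_ : mkset _ = (fun w => tnth (Z w) p) @^-1` `]-oo, t]).
    have mt : measurable_fun setT (fun w => tnth (Z w) p).
      exact: (measurableT_comp (measurable_tnth p) (measurable_funPT Z)).
    exact: mt.
  by apply/seteqP; split => w /=; rewrite in_itv.
move=> s t st; apply: fine_le; try exact: fin_num_measure.
apply: le_measure; rewrite ?inE//.
by move=> w /= /le_trans; apply.
Qed.

Lemma marginal_df_range (Z : T -> d.-tuple R) p t :
  measurable [set w | tnth (Z w) p <= t] -> 0 <= marginal_df P Z p t <= 1.
Proof.
move=> mA; rewrite fine_ge0//= -lee_fin fineK ?fin_num_measure//.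
exact: probability_le1.
Qed.

Lemma measurable_sample (X : int -> {RV P >-> d.-tuple R}) n :
  measurable_fun setT (sample X n).
Proof.
apply/measurable_fun_tnthP => i.
rewrite (_ : _ \o _ = X i.+1); first exact: measurable_funPT.
by apply/funext => w; rewrite /= tnth_mktuple.
Qed.

Lemma measurable_is_weight n : measurable [set m : n.-tuple R | is_weight m].
Proof.
rewrite (_ : mkset _ = (\bigcap_(i in [set: 'I_n])
    ((fun m : n.-tuple R => tnth m i) @^-1` `[0, +oo[)) `&`
    ((fun m : n.-tuple R => \sum_(i < n) tnth m i) @^-1` [set n%:R])).
  apply: measurableI.
    apply: fin_bigcap_measurable => [|i _]; first exact: finite_finset.
    rewrite -[X in measurable X]setTI.
    exact: measurable_tnth.
  rewrite -[X in measurable X]setTI.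
  have ms : measurable_fun setT (fun m : n.-tuple R => \sum_(i < n) tnth m i).
    by apply: measurable_sum => i; exact: measurable_tnth.
  by apply: ms.
apply/seteqP; split => m /= [h1 h2]; split=> //.
  by move=> i _; rewrite /= in_itv/= h1.
by move=> i; have := h1 i I; rewrite /= in_itv/= andbT.
Qed.

End sampling.

Theorem corollary2p11 (R : realType) (d : nat) (hd : (2 <= d)%N)
  (dO : measure_display) (Omega : measurableType dO) (P : probability Omega R)
  (X : int -> {RV P >-> d.-tuple R})
  (M : forall n, {RV P >-> n.-tuple R})
  (K : forall n, R.-pker (n.-tuple (d.-tuple R)) ~> (n.-tuple R))
  (C : 'rV[R]_d -> R)
  (dO' : measure_display) (Omega' : measurableType dO')
  (P' : probability Omega' R) (B : Omega' -> linfty R (cube R d))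
  (F := marginal_df P (X 0)) (Xs := sample X)
  (stat : strictly_stationary P X)
  (contF : forall p, continuous (F p))
  (copC : copula_of P (X 0) C)
  (M_ge0 : forall n, {ae P, forall w, forall i, 0 <= tnth (M n w) i})
  (M_sum : forall n, {ae P, forall w, \sum_(i < n) tnth (M n w) i = n%:R})
  (K_law : forall n, is_cond_law P (Xs n) (M n) (K n))
  (B_tight : tight P' B)
  (B_gauss : gaussian_field P' B)
  (B_centered : centered_field P' B)
  (B_D0 : P' (B @^-1` D0) = 1%E)
  (alpha_cvg : weak_cvg P (fun n w => alpha F C (Xs n w)) P' B)
  (alpha_boot_cvg : cond_weak_cvg P Xs M K (fun n x m => alpha_boot F x m) P' B)
  (C_derivable : forall p u, cube R d u -> 0 < u ord0 p < 1 ->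
     has_pderive C p u)
  (C_pderive_cont : forall p,
     {within [set u | cube R d u /\ 0 < u ord0 p < 1],
        continuous (pderive C p)}) :
  gaussian_field P' (fun w => copula_derivative C (B w)) /\
  cond_weak_cvg P Xs M K (fun n x m => copula_boot x m)
    P' (fun w => copula_derivative C (B w)).
Proof.
have [isC _] := copC.
split; first exact: gaussian_copula_derivative isC C_derivable B B_gauss.
have mF p : measurable_fun setT (F p) by exact: continuous_measurable_fun.
have F_homo p : {homo F p : s t / s <= t} by exact: marginal_df_homo.
have F01 p t : 0 <= F p t <= 1.
  apply: marginal_df_range; rewrite -[X in measurable X]setTI.
  rewrite (_ : mkset _ = (fun w => tnth (X 0 w) p) @^-1` `]-oo, t]).
    have mt : measurable_fun setT (fun w => tnth (X 0 w) p).
      exact: (measurableT_comp (measurable_tnth p) (measurable_funPT (X 0))).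
    exact: mt.
  by apply/seteqP; split => w /=; rewrite in_itv.
have mXs n : measurable_fun setT (Xs n) by exact: measurable_sample.
have mM n : measurable_fun setT (M n) by exact: measurable_funPT.
have [mB _ _] := alpha_boot_cvg.
have d1 : 1 <= d.+1%:R :> R by rewrite ler1n.
apply: (cond_weak_cvg_perturb mXs mM K_law d1
  (copula_derivative_lip isC C_derivable) _ alpha_boot_cvg) => e x e0 x0.
have c0 : 0 < 4 * (7 * d%:R + 1) :> R by rewrite mulr_gt0// ltr_wpDl// mulr_ge0.
pose g := e / (4 * (7 * d%:R + 1)).
have g0 : 0 < g by rewrite divr_gt0.
pose c := Num.min 1 (g / 2).
have c_gt0 : 0 < c by rewrite lt_min ltr01 divr_gt0.
have cx0 : 0 < c * x / 8 by rewrite divr_gt0// mulr_gt0.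
(* The scale of the gauge, chosen from the limit law before the sample size. *)
have [k hk] : exists k, mean P' (fun w => gauge_test k (B w)) <= c * x / 8.
  have /cvgrPdist_le/(_ _ cx0)[k _ /(_ k (leqnn k))] := mean_gauge_test_cvg mB B_D0.
  by rewrite /= sub0r normrN => h; exists k; apply: le_trans (ler_norm _) h.
have fBL := @gauge_test_BL1 R d k.
have f_ge (z : linfty R (cube R d)) : g < gauge k z -> c <= gauge_test k z.
  by move=> gz; rewrite le_min ge_min lexx/= ge_min ler_pM2r ?invr_gt0// (ltW gz) orbT.
have [N hN] := remainder_eventually_small F_homo F01 isC C_derivable C_pderive_cont k g.
have P1 : P setT = 1%E by exact: probability_setT.
have fa_cvg : \forall n \near \oo,
    outer_mean P (fun w => gauge_test k (alpha F C (Xs n w))) <= c * x / 4.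
  have [_ /(_ _ (BL1_continuous fBL))] := alpha_cvg.
  move=> /(_ (ex_intro _ 1 fBL.1)); rewrite expectation_mean; last exact: BL1_bounded_measurable.
  move=> /fine_cvgP[_ /cvgrPdist_le/(_ _ cx0)]; apply: filterS => n /=.
  by rewrite -/(outer_mean _ _) ler_norml => /andP[? ?]; lra.
have fb := asymptotic_upper mXs mM K_law mB alpha_boot_cvg fBL cx0.
near=> n.
have [u [bu hu mu]] : exists u : n.-tuple (d.-tuple R) * n.-tuple R -> R,
  [/\ bounded_measurable u, forall z, gauge_test k (alpha_boot F z.1 z.2) <= u z &
      mean P (u \o (fun w => (Xs n w, M n w))) <=
      mean P' (fun w => gauge_test k (B w)) + c * x / 8].
  by near: n; exact: fb.
have fan : outer_mean P (fun w => gauge_test k (alpha F C (Xs n w))) <= c * x / 4.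
  by near: n; exact: fa_cvg.
pose J w := (Xs n w, M n w).
have mJ : measurable_fun setT J by exact: (measurable_fun_pair (mXs n) (mM n)).
pose Ba := rough_set F C (n := n) k g.
have mBa : measurable Ba by exact: measurable_rough_set.
pose Bb := [set z | c <= u z].
have mBb : measurable Bb.
  rewrite -[X in measurable X]setTI (_ : Bb = u @^-1` `[c, +oo[); first by apply: bu.1.
  by apply/seteqP; split => z /=; rewrite in_itv/= andbT.
pose Bm := ~` [set m : n.-tuple R | is_weight m].
have mBm : measurable Bm by apply: measurableC; exact: measurable_is_weight.
have mfst : measurable (fst @^-1` Ba : set (n.-tuple (d.-tuple R) * n.-tuple R)).
  by rewrite -[X in measurable X]setTI; exact: measurable_fst.
have msnd : measurable (snd @^-1` Bm : set (n.-tuple (d.-tuple R) * n.-tuple R)).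
  by rewrite -[X in measurable X]setTI; exact: measurable_snd.
(* The samples with a rough [alpha], the pairs with a possibly rough [alpha_boot],
   and the weights that are negative or do not add up to the sample size. *)
exists (fst @^-1` Ba `|` Bb `|` snd @^-1` Bm); split.
- by apply: measurableU => //; exact: measurableU.
- have m1 : measurable (Xs n @^-1` Ba) by rewrite -[X in measurable X]setTI; exact: mXs.
  have m2 : measurable (J @^-1` Bb) by rewrite -[X in measurable X]setTI; exact: mJ.
  have m3 : measurable (M n @^-1` Bm) by rewrite -[X in measurable X]setTI; exact: mM.
  have p1 : (P (Xs n @^-1` Ba) <= (x / 4)%:E)%E.
    have bA : bounded_measurable (\1_(Xs n @^-1` Ba) : Omega -> R).
      exact: bounded_measurable_indic.
    rewrite (mean_indic P1 m1) lee_fin -(ler_pM2l c_gt0) -(meanZ P1 c bA).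
    apply: (@le_trans _ _ (c * x / 4)); last by rewrite mulrA.
    apply: le_trans fan.
    apply: (mean_le_outer_mean P1 (c := 1)) => [w||w]; first exact: fBL.1.
      exact: bounded_measurableZ.
    rewrite indicE; have [|_] := boolP (w \in _); last by rewrite mulr0 gauge_test_ge0.
    by rewrite inE mulr1 => /gauge_gt_rough; exact: f_ge.
  have p2 : (P (J @^-1` Bb) <= (x / 4)%:E)%E.
    have bJ := bounded_measurable_comp mJ bu.
    have uJ0 w : 0 <= (u \o J) w.
      exact: le_trans (gauge_test_ge0 _ _) (hu (J w)).
    apply: le_trans (mean_markov P1 bJ uJ0 c_gt0) _.
    by rewrite lee_fin ler_pdivrMr//; lra.
  have p3 : P (M n @^-1` Bm) = 0%E.
    apply: measure_negligible => //.
    apply: negligibleS (filterI (M_ge0 n) (M_sum n)) => w /= nw [h1 h2].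
    by apply: nw; split.
  rewrite (_ : _ @^-1` _ = Xs n @^-1` Ba `|` J @^-1` Bb `|` M n @^-1` Bm)//.
  apply: le_trans (measureU2 _ _ _) _ => //; first exact: measurableU.
  have p3' : (P (M n @^-1` Bm) <= 0)%E by rewrite p3.
  apply: le_trans (leeD (le_trans (measureU2 _ m1 m2) (leeD p1 p2)) p3') _.
  by rewrite adde0 -EFinD lee_fin; lra.
- case=> xs m /= nb.
  have nBa : ~ Ba xs by move=> h; apply: nb; left; left.
  have nBb : ~ Bb (xs, m) by move=> h; apply: nb; left; right.
  have wm : is_weight m by apply: contrapT => h; apply: nb; right.
  have ga := gauge_le_smooth isC (ltW g0) nBa.
  have gb : gauge k (alpha_boot F xs m) <= g.
    rewrite leNgt; apply/negP => /f_ge h; apply: nBb.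
    exact: le_trans h (hu (xs, m)).
  apply: le_trans (hN n xs m _ wm ga gb) _; first by near: n; exact: nbhs_infty_ge.
  by rewrite /g mulrC divfK// gt_eqF.
Unshelve. all: by end_near.
Qed.
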